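(* Let $k$ be a positive integer. If a signed graph $(G,\sigma)$ is $(12k-1)$-edge connected and essentially $(2k+1)$-unbalanced, then $(G,\sigma)$ admits a $(2k+1,k)$-flow.
   Context: A signed graph is a pair $(G,\sigma)$ where $G$ is a graph and $\sigma:E(G)\to\{1,-1\}$; edges with $\sigma(e)=1$ are positive, those with $\sigma(e)=-1$ negative. An orientation $\tau$ of $(G,\sigma)$ orients each positive edge $e=xy$ from one end to the other (if from $x$ to $y$, then $e\in E^+_\tau(x)\cap E^-_\tau(y)$), and labels each negative edge $e=xy$ either as a sink edge, with $e\in E^+_\tau(x)\cap E^+_\tau(y)$, or as a source edge, with $e\in E^-_\tau(x)\cap E^-_\tau(y)$. An integer flow is an orientation $\tau$ together with $f:E(G)\to\mathbb{Z}$ such that $\sum_{e\in E^+_\tau(v)}f(e)-\sum_{e\in E^-_\tau(v)}f(e)=0$ for every vertex $v$. For positive integers $p\ge 2q$, a $(p,q)$-flow is an integer flow with $f(e)\in\{q,q+1,\dots,p-q\}$ for every edge $e$. In particular, a $(2k+1,k)$-flow has $f(e)\in\{k,k+1\}$ for every edge $e$. Switching at a vertex $v$ negates the sign of every edge incident to $v$. Two signed graphs on the same underlying graph are equivalent if one is obtained from the other by a sequence of switchings. $(G,\sigma)$ is essentially $(2k+1)$-unbalanced if every signed graph equivalent to it has either an even number of negative edges or at least $2k+1$ negative edges. Edge connectivity refers to $G$. *)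

(* Defs.v *)
(* Signed graphs as finite multigraphs (parallel edges and
   loops allowed) given by an endpoint map ends : E -> V * V. *)
From HB Require Import structures.
From mathcomp Require Import all_boot all_order all_algebra.
From Stdlib Require Import Relations.
Set Implicit Arguments. Unset Strict Implicit. Unset Printing Implicit Defensive.
Import Order.TTheory GRing.Theory Num.Theory.

Section SignedGraphs.
Variables (V E : finType) (ends : E -> V * V).

(* A signature: sigma e = true  iff  e is a NEGATIVE edge (sigma(e) = -1). *)
Definition signature := {ffun E -> bool}.

Definition negative_edges (sigma : signature) : {set E} := [set e | sigma e].

(* Switching at v: negates the sign of every edge with exactly one end at v
   (a loop at v is incident to v twice and keeps its sign, the standard
   convention sigma'(uv) = s(u) sigma(uv) s(v)). *)
Definition switch_at (v : V) (sigma : signature) : signature :=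
  [ffun e => sigma e (+) (((ends e).1 == v) (+) ((ends e).2 == v))].

Definition switching_equivalent (sigma sigma' : signature) : Prop :=
  clos_refl_trans signature
    (fun a b => exists v : V, b = switch_at v a) sigma sigma'.

Definition essentially_unbalanced (m : nat) (sigma : signature) : Prop :=
  forall sigma', switching_equivalent sigma sigma' ->
    ~~ odd #|negative_edges sigma'| \/ m <= #|negative_edges sigma'|.

Definition edge_connected (m : nat) : Prop :=
  forall S : {set V}, S != set0 -> S != setT ->
    m <= #|[set e | ((ends e).1 \in S) != ((ends e).2 \in S)]|.

(* An orientation assigns to each of the two ends (half-edges) of e a bit:
   true means e \in E^+_tau(end), false means e \in E^-_tau(end).
   Positive edge: the two ends get opposite bits (oriented from one end to
   the other); negative edge: equal bits (true,true = sink edge,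
   false,false = source edge). *)
Definition orientation (sigma : signature) (tau : E -> bool * bool) : Prop :=
  forall e, ((tau e).1 == (tau e).2) = sigma e.

Definition half_val (b : bool) (x : int) : int := if b then x else (- x)%R.

Definition conservation (tau : E -> bool * bool) (f : E -> int) : Prop :=
  forall v : V,
    (\sum_(e | (ends e).1 == v) half_val (tau e).1 (f e)
     + \sum_(e | (ends e).2 == v) half_val (tau e).2 (f e) = 0)%R.

Definition pq_flow (p q : nat) (sigma : signature) : Prop :=
  exists (tau : E -> bool * bool) (f : E -> int),
    [/\ orientation sigma tau, conservation tau f &
        forall e, (q%:Z <= f e <= p%:Z - q%:Z)%R].

End SignedGraphs.

(* Main.v *)
(** Switch so that the number of negative edges is minimum: every cut then has
    at least as many positive as negative edges, hence at least [6k] positive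
    ones.  The negative edges are labelled and given values in [{k, k+1}]
    first, and the positive edges complete this to a flow, in two stages.

    Modulo [2k+1] this is the theorem of Lovász, Thomassen, Wu and Zhang that
    in a [6k]-edge-connected graph all out-degrees can be prescribed modulo
    [2k+1].  It is proved by induction for graphs in which the edges at one
    vertex [z0] are already oriented: nearly tight cuts are contracted on both
    sides, and otherwise an edge can be oriented and deleted or two edges
    split off.

    A modular flow is made integral by reversing directed paths, which
    succeeds as soon as the demand of the negative edges on a set [A] is at
    most [k d(A) + 2k], [d] counting positive edges.  To get such labels,
    pack two disjoint spanning trees in the positive graph, delete from the
    signed graph a subset of the first tree so that all degrees become even,
    and follow an Euler tour of what remains (connected by the second tree):
    a label changes at each negative edge, so the positive edges of the tour
    carry the demand.  If the number [N] of negative edges is odd, the tour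
    leaves a defect of 2 at its origin; [k] of the [(N-1)/2 >= k] source edges
    then get the value [k+1] to compensate. *)
Require Import Defs.
From HB Require Import structures.
From mathcomp Require Import all_boot all_order all_algebra.
From mathcomp Require Import zify.
From Stdlib Require Import Classical Relations.
Set Implicit Arguments. Unset Strict Implicit. Unset Printing Implicit Defensive.
Import Order.TTheory GRing.Theory Num.Theory.

(** * Integer sums over finite sets *)

Definition isum (T : finType) (S : {set T}) (f : T -> int) : int := (\sum_(i in S) f i)%R.
Notation "\sumz_ ( i 'in' S ) F" := (isum S (fun i => F%R))
  (at level 41, F at level 41, i, S at level 50, format "\sumz_ ( i  'in'  S )  F").

Section IntegerSums.
Local Open Scope ring_scope.
Variables T U : finType.
Implicit Types (S : {set T}) (f g : T -> int).

Lemma eq_isum S f g : {in S, f =1 g} -> isum S f = isum S g.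
Proof. by move=> fg; apply: eq_bigr. Qed.

Lemma isumD S f g : \sumz_(i in S) (f i + g i) = isum S f + isum S g.
Proof. exact: big_split. Qed.

Lemma isumN S f : \sumz_(i in S) (- f i) = - isum S f.
Proof. exact: sumrN. Qed.

Lemma isumB S f g : \sumz_(i in S) (f i - g i) = isum S f - isum S g.
Proof. by rewrite isumD isumN. Qed.

Lemma isumZ S (a : int) f : \sumz_(i in S) (a * f i) = a * isum S f.
Proof. by rewrite /isum -mulr_sumr. Qed.

Lemma isum0 S f : {in S, forall i, f i = 0} -> isum S f = 0.
Proof. by move=> f0; apply: big1. Qed.

Lemma isum_ge0 S f : (forall i, 0 <= f i) -> 0 <= isum S f.
Proof. by move=> f0; apply: sumr_ge0. Qed.

Lemma isum_le S f g : {in S, forall i, f i <= g i} -> isum S f <= isum S g.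
Proof. by move=> fg; apply: ler_sum. Qed.

Lemma isum_set0 f : isum set0 f = 0.
Proof. exact: big_set0. Qed.

Lemma isum_set1 x f : isum [set x] f = f x.
Proof. exact: big_set1. Qed.

Lemma isum_setD1 S x f : x \in S -> isum S f = f x + isum (S :\ x) f.
Proof. by move=> xS; rewrite /isum (big_setD1 x). Qed.

Lemma isum_setU1 S x f : x \notin S -> isum (x |: S) f = f x + isum S f.
Proof. by move=> xS; rewrite /isum big_setU1. Qed.

Lemma isum_filter S (P : pred T) f :
  isum [set i in S | P i] f = \sumz_(i in S) (if P i then f i else 0).
Proof. by rewrite /isum -big_mkcondr /=; apply: eq_bigl => i; rewrite inE. Qed.

Lemma isum_exchange S (S' : {set U}) (f : T -> U -> int) :
  \sumz_(i in S) \sumz_(j in S') f i j = \sumz_(j in S') \sumz_(i in S) f i j.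
Proof. exact: exchange_big. Qed.

Lemma isum_and_eq x S (P : bool) : \sumz_(v in S) (P && (x == v))%:Z = (P && (x \in S))%:Z.
Proof.
case: P => /=; last exact: isum0.
have [xS|xS] := boolP (x \in S).
  rewrite (isum_setD1 _ xS) eqxx isum0 // => v; rewrite !inE eq_sym => /andP[/negPf-> _] //.
by apply: isum0 => v vS; case: eqP => // xv; rewrite xv vS in xS.
Qed.

Lemma isum_pt x S : \sumz_(v in S) (x == v)%:Z = (x \in S)%:Z.
Proof. exact: (isum_and_eq x S true). Qed.

Lemma isum_card S (N : {set T}) : N \subset S -> \sumz_(i in S) (i \in N)%:Z = #|N|%:Z.
Proof.
move=> NS; rewrite /isum -sum1_card (big_morph Posz PoszD (erefl _)) [RHS]big_mkcond [LHS]big_mkcond /=.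
apply: eq_bigr => e _; case eN: (e \in N); last by case: ifP.
by rewrite (subsetP NS).
Qed.
End IntegerSums.

(** * Orientations with prescribed out-degrees modulo k *)
Section ModularOrientations.
Local Open Scope ring_scope.
Variables (V E : finType) (k : int).
Implicit Types (p : E -> V * V) (F : {set E}) (A B X Q : {set V}).
Implicit Types (s r b : V -> int) (o : E -> bool) (e : E) (v z : V) (w d : int).

Definition crossing p A e : bool := ((p e).1 \in A) (+) ((p e).2 \in A).
Definition inside p A e : bool := ((p e).1 \in A) && ((p e).2 \in A).
Definition tail p o e : V := if o e then (p e).1 else (p e).2.
Definition tip p o e : V := if o e then (p e).2 else (p e).1.

Definition cut_size F p r b A : int :=
  \sumz_(e in F) (crossing p A e)%:Z + isum A r + isum A b.
(** The out-degrees in [A] count each edge inside [A] exactly once, under any orientation; what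
    remains must leave [A]. *)
Definition cut_demand F p s A : int :=
  isum A s - \sumz_(e in F) (inside p A e)%:Z.

(* The data [(X, F, p, s, r, b)] describe the graph [z0 + (X, F)]: [r v] edges
   are oriented from [z0] to [v] and [b v] from [v] to [z0], and [s v] is the
   out-degree required at [v] modulo [k], those [b v] edges included.  A set
   [A] then has [cut_size A] edges leaving it, of which [cut_demand A] modulo
   [k] must be oriented outwards; [admissible] asks that this residue class
   meet [[k - 1, cut_size - (k - 1)]], which holds as soon as
   [cut_size >= 3 (k - 1)]. *)
Definition admissible w d := exists j : int, k - 1 <= w - j * k <= d - (k - 1).
(** Admissibility with room for one operation: it becomes [admissible] again after [w] drops by one
    and [d] by two. *)
Definition slack w d := exists j : int, k <= w - j * k <= d - k.

(* Equivalent, with [M = 2 k] and [|.|_M] the distance to [M Z], to the bound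
   [R + B <= 2 (k - 1) + |R - B|_M] on the degree of [z0] in the theorem of
   Lovász, Thomassen, Wu and Zhang. *)
Definition token_bound (R B : int) :=
  (R <= 2 * k - 1 /\ B <= k - 1) \/ (R <= k - 1 /\ B <= 2 * k - 1).

(* [Q] is empty, or a single vertex exempted from the cut condition. *)
Record token_instance X F p s r b Q : Prop := Inst {
  i_wf : forall e, e \in F -> ((p e).1 \in X) && ((p e).2 \in X);
  i_r : forall v, 0 <= r v;
  i_b : forall v, 0 <= b v;
  i_few : token_bound (isum X r) (isum X b);
  i_sum : exists j, cut_demand F p s X = isum X b + j * k;
  i_cut : forall A, A \subset X -> A != X -> ~~ (A \subset Q) ->
    admissible (cut_demand F p s A) (cut_size F p r b A) }.

Definition solves X F p s b o := forall v, v \in X ->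
  exists j, \sumz_(e in F) (tail p o e == v)%:Z + b v = s v + j * k.

(* Contracting the complement of a cut without slack yields a new [z0] that
   again satisfies [token_bound]. *)
Lemma token_bound_tight (R B : int) w d : 1 <= k -> 0 <= R -> 0 <= B -> R + B = d ->
  (exists j, B = w + j * k) -> admissible w d -> ~ slack w d -> token_bound R B.
Proof.
move=> k1 R0 B0 RB [j Bj] [i /andP[ok1 ok2]] nsl; rewrite /token_bound.
(* The failure at [i] puts [w - i * k] at an end of the admissible interval; the failures at [i - 1]
   and [i + 1] then give [d <= 3 * k - 2]. *)
have nsl0 : ~ (k <= w - i * k <= d - k) by move=> H; apply: nsl; exists i.
have nsl1 : ~ (k <= w - (i - 1) * k <= d - k) by move=> H; apply: nsl; exists (i - 1).
have nsl2 : ~ (k <= w - (i + 1) * k <= d - k) by move=> H; apply: nsl; exists (i + 1).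
have [yk|yk] : w - i * k = k - 1 \/ w - i * k = d - k + 1 by lia.
  have B' : B = k - 1 + (i + j) * k by lia.
  have : (i + j <= -1) \/ i + j = 0 \/ i + j = 1 \/ (2 <= i + j) by lia.
  by move: (i + j) B' => t B' [|[|[|]]] Ht; nia.
have R' : R = k - 1 + (- i - j) * k by lia.
have : (- i - j <= -1) \/ - i - j = 0 \/ - i - j = 1 \/ (2 <= - i - j) by lia.
by move: (- i - j) R' => t R' [|[|[|]]] Ht; nia.
Qed.

(** * Contraction of vertex sets *)

Section Collapse.
Variables (X : {set V}) (F : {set E}) (p : E -> V * V) (c : V -> V).
Hypothesis wf : forall e, e \in F -> ((p e).1 \in X) && ((p e).2 \in X).

Definition pushf s v : int := isum [set u in X | c u == v] s.
Definition pushp e := (c (p e).1, c (p e).2).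
Definition pullset A := [set u in X | c u \in A].

Lemma sum_pushf s A : \sumz_(v in A) pushf s v = isum (pullset A) s.
Proof.
rewrite /pushf [RHS]/isum (partition_big c (mem A)) /=; last by move=> u; rewrite inE => /andP[].
apply: eq_bigr => v vA; apply: eq_bigl => u; rewrite !inE.
by case: eqP => [->|]; rewrite ?vA ?andbF ?andbT.
Qed.

Lemma crs_push A e : e \in F -> crossing pushp A e = crossing p (pullset A) e.
Proof. by move=> /wf /andP[h1 h2]; rewrite /crossing !inE h1 h2. Qed.

Lemma inn_push A e : e \in F -> inside pushp A e = inside p (pullset A) e.
Proof. by move=> /wf /andP[h1 h2]; rewrite /inside !inE h1 h2. Qed.

Lemma cutw_push r b A : cut_size F pushp (pushf r) (pushf b) A = cut_size F p r b (pullset A).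
Proof.
rewrite /cut_size !sum_pushf; congr (_ + _ + _).
by apply: eq_bigr => e eF; rewrite crs_push.
Qed.

Lemma outw_push s A : cut_demand F pushp (pushf s) A = cut_demand F p s (pullset A).
Proof.
rewrite /cut_demand !sum_pushf; congr (_ - _).
by apply: eq_bigr => e eF; rewrite inn_push.
Qed.

(** The cuts of the contraction are the cuts of the original graph that split no fibre of [c], with
    the same size and demand. The hypothesis on [Q'] says that those to be checked were not exempt
    before. *)
Lemma inst_push s r b Q Q' : token_instance X F p s r b Q ->
  (forall A, A \subset c @: X -> ~~ (A \subset Q') -> ~~ (pullset A \subset Q)) ->
  token_instance (c @: X) F pushp (pushf s) (pushf r) (pushf b) Q'.
Proof.
case=> _ r0 b0 hf hs hc hQ.
have preX : pullset (c @: X) = X.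
  by apply/setP=> u; rewrite inE; case uX: (u \in X) => //=; rewrite imset_f.
split.
- by move=> e /wf /andP[h1 h2]; rewrite /= !imset_f.
- by move=> v; apply: isum_ge0.
- by move=> v; apply: isum_ge0.
- by rewrite !sum_pushf preX.
- by rewrite outw_push sum_pushf preX.
move=> A AX AnX AQ; rewrite outw_push cutw_push; apply: hc.
- by apply/subsetP=> u; rewrite inE => /andP[].
- apply: contra AnX => /eqP pX; rewrite eqEsubset AX; apply/subsetP=> v /imsetP[u uX ->].
  by move: uX; rewrite -pX inE => /andP[].
- exact: hQ.
Qed.
End Collapse.

(** * Solving outside and then inside a set *)

Definition squash A a v := if v \in A then a else v.

Section Restrict.
Variables (X A : {set V}) (F : {set E}) (p : E -> V * V) (s r b : V -> int) (o : E -> bool).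
Hypothesis wf : forall e, e \in F -> ((p e).1 \in X) && ((p e).2 \in X).
Hypothesis AX : A \subset X.

Definition inner_edges := [set e in F | inside p A e].
(** Once the contraction of [A] is oriented, the complement of [A] merges with [z0], and each
    crossing edge becomes a token at its end in [A]. *)
Definition inner_r v : int := r v + \sumz_(e in F) (crossing p A e && (tip p o e == v))%:Z.
Definition inner_b v : int := b v + \sumz_(e in F) (crossing p A e && (tail p o e == v))%:Z.

Lemma sum_resr B : isum B inner_r =
  isum B r + \sumz_(e in F) (crossing p A e && (tip p o e \in B))%:Z.
Proof.
rewrite isumD isum_exchange; congr (_ + _).
by apply: eq_isum => e _; rewrite isum_and_eq.
Qed.

Lemma sum_resb B : isum B inner_b =
  isum B b + \sumz_(e in F) (crossing p A e && (tail p o e \in B))%:Z.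
Proof.
rewrite isumD isum_exchange; congr (_ + _).
by apply: eq_isum => e _; rewrite isum_and_eq.
Qed.

Lemma big_resF (f : E -> int) : isum inner_edges f = \sumz_(e in F) (if inside p A e then f e else 0).
Proof. exact: isum_filter. Qed.

Lemma cutw_res B : B \subset A -> cut_size inner_edges p inner_r inner_b B = cut_size F p r b B.
Proof.
move=> BA; rewrite /cut_size sum_resr sum_resb big_resF.
suff -> : \sumz_(e in F) (crossing p B e)%:Z = \sumz_(e in F) (if inside p A e then (crossing p B e)%:Z else 0)
  + \sumz_(e in F) (crossing p A e && (tip p o e \in B))%:Z
  + \sumz_(e in F) (crossing p A e && (tail p o e \in B))%:Z :> int by lia.
rewrite -!isumD; apply: eq_isum => e _; rewrite /crossing /inside /tip /tail.
have := subsetP BA (p e).1; have := subsetP BA (p e).2.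
by case: (o e); do 4 case: (_ \in _) => //=; lia.
Qed.

Lemma outw_res B : B \subset A -> cut_demand inner_edges p s B = cut_demand F p s B.
Proof.
move=> BA; rewrite /cut_demand big_resF; congr (_ - _); apply: eq_bigr => e _.
rewrite /inside; have := subsetP BA (p e).1; have := subsetP BA (p e).2.
by do 4 case: (_ \in _) => //=; lia.
Qed.

(** At the contracted vertex [a] the orientation meets the demand of [A], so the new [b]-tokens have
    the residue required by the sum condition. As [A] has no slack, [token_bound_tight] bounds the
    tokens of the new [z0]. *)
Lemma inst_res Q a : token_instance X F p s r b Q -> 1 <= k -> a \in A -> A != X -> ~~ (A \subset Q) ->
  ~ slack (cut_demand F p s A) (cut_size F p r b A) ->
  solves (squash A a @: X) F (pushp p (squash A a)) (pushf X (squash A a) s) (pushf X (squash A a) b) o ->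
  token_instance A inner_edges p s inner_r inner_b Q.
Proof.
move=> [_ r0 b0 hf hs hc] k1 aA AnX AQ nsl so.
have okA := hc A AX AnX AQ.
have aX := subsetP AX _ aA.
have pre_a : pullset X (squash A a) [set a] = A.
  apply/setP=> u; rewrite !inE /squash; case uA: (u \in A); first by rewrite eqxx (subsetP AX _ uA).
  by rewrite andbC; case: eqP => // ua; rewrite ua aA in uA.
have := so a; have -> : a \in squash A a @: X by apply/imsetP; exists a => //; rewrite /squash aA.
have pf f : pushf X (squash A a) f a = isum A f.
  by have := sum_pushf X (squash A a) f [set a]; rewrite isum_set1 pre_a.
rewrite !pf => /(_ isT) [j hj].
(* Edges inside [A] become loops at [a], where each counts once under either orientation. *)
have outA : \sumz_(e in F) (tail (pushp p (squash A a)) o e == a)%:Z =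
   \sumz_(e in F) (inside p A e)%:Z + \sumz_(e in F) (crossing p A e && (tail p o e \in A))%:Z :> int.
  rewrite -isumD; apply: eq_isum => e eF; rewrite /tail /inside /crossing /pushp /squash /=.
  have h u : ((if u \in A then a else u) == a) = (u \in A).
    by case uA: (u \in A); rewrite ?eqxx //; case: eqP => // ua; rewrite ua aA in uA.
  by case: (o e); rewrite /= h; do 2 case: (_ \in _).
have Bsum := sum_resb A.
have hB : exists j, isum A inner_b = cut_demand F p s A + j * k.
  by exists j; rewrite Bsum /cut_demand; move: hj; rewrite outA; lia.
have ge0 (f : V -> int) : (forall v, 0 <= f v) -> 0 <= isum A f by exact: isum_ge0.
have rr v : 0 <= inner_r v by apply: addr_ge0 => //; apply: isum_ge0.
have rb v : 0 <= inner_b v by apply: addr_ge0 => //; apply: isum_ge0.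
split=> //.
- by move=> e; rewrite inE => /andP[_].
- apply: (token_bound_tight _ _ _ _ hB okA nsl) => //; try exact: ge0.
  rewrite -(cutw_res (subxx A)) /cut_size [X in _ = X + _ + _]isum0 ?add0r //.
  by move=> e; rewrite inE /crossing /inside => /andP[_ /andP[-> ->]].
- by case: hB => i hi; exists (- i); rewrite outw_res // hi mulNr addrK.
move=> B BA BnA BQ; rewrite outw_res // cutw_res //; apply: hc => //.
  exact: subset_trans AX.
apply: contra BnA => /eqP BX; rewrite eqEsubset BA BX; exact: AX.
Qed.

Lemma sol_glue a o2 : a \in A ->
  solves (squash A a @: X) F (pushp p (squash A a)) (pushf X (squash A a) s) (pushf X (squash A a) b) o ->
  solves A inner_edges p s inner_b o2 ->
  solves X F p s b (fun e => if inside p A e then o2 e else o e).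
Proof.
move=> aA so1 so2 v vX; set o' := (fun e => if _ then _ else _).
case vA: (v \in A).
  have [j hj] := so2 v vA; exists j; rewrite -hj /inner_b addrA addrAC; congr (_ + _).
  rewrite big_resF -isumD; apply: eq_isum => e eF.
  rewrite /tail /o' /inside /crossing.
  case h1: ((p e).1 \in A); case h2: ((p e).2 \in A) => //=; rewrite ?addr0 ?add0r //.
  have nv u : (u \in A) = false -> (u == v) = false by move=> uA; apply/eqP => uv; rewrite uv vA in uA.
  by case: (o e); rewrite ?(nv _ h1) ?(nv _ h2).
have := so1 v; have -> : v \in squash A a @: X by apply/imsetP; exists v; rewrite // /squash vA.
have pf f : pushf X (squash A a) f v = f v.
  rewrite /pushf /isum (big_pred1 v) // => u; rewrite inE /squash /=.
  case uA: (u \in A); last by case: eqP => [->|]; rewrite ?vX ?andbF.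
  rewrite [RHS](_ : _ = false); last by apply/eqP => uv; rewrite -uv uA in vA.
  by case: eqP => [av|]; rewrite ?andbF // -av aA in vA *.
rewrite !pf => /(_ isT) [j hj]; exists j; rewrite -hj; congr (_ + _); apply: eq_bigr => e eF.
rewrite /tail /o' /inside /pushp /squash /=.
have av : a == v = false by apply/eqP => av; rewrite -av aA in vA.
have h u : u \in A -> u == v = false by move=> uA; apply/eqP => uv; rewrite -uv uA in vA.
case h1: ((p e).1 \in A); case h2: ((p e).2 \in A) => /=; case: (o e); case: (o2 e);
  by rewrite ?h1 ?h2 ?av ?(h _ h1) ?(h _ h2).
Qed.
End Restrict.
End ModularOrientations.

(** * Instances with an exempt vertex *)

Section Exempt.
Local Open Scope ring_scope.
Variables (V E : finType) (k : int).
Implicit Types (p : E -> V * V) (F : {set E}) (A B X Q : {set V}).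
Implicit Types (s r b : V -> int) (o : E -> bool) (e : E) (v z u : V) (w d : int).

Notation cut_size := (@cut_size V E).
Notation cut_demand := (@cut_demand V E).

Definition solvable X F p s b := exists o, solves k X F p s b o.
(** Half of the edges at [z], counting tokens but not loops, must leave it modulo [k]. Splitting off
    a pair of edges at [z] preserves this. *)
Definition balanced F p s r b z :=
  exists h j : int, cut_size F p r b [set z] = 2 * h /\ cut_demand F p s [set z] = h + j * k.

Lemma card_squash A X a : a \in A -> A \subset X -> (1 < #|A|)%N -> (#|squash A a @: X| < #|X|)%N.
Proof.
move=> aA AX A1; apply: proper_card; apply/properP; split.
  apply/subsetP=> v /imsetP[u uX ->]; rewrite /squash; case: ifP => // _; exact: (subsetP AX).
have /card_gt0P[x] : (0 < #|A :\ a|)%N by move: A1; rewrite (cardsD1 a A) aA.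
rewrite !inE => /andP[xa xA]; exists x; first exact: (subsetP AX).
apply/imsetP => -[u uX]; rewrite /squash; case: ifP => [_ xu|uA xu]; first by rewrite xu eqxx in xa.
by rewrite -xu xA in uA.
Qed.

(** A cut without slack reduces the instance to the contraction of [A] and the inside of [A], in
    this order: the orientation found on the contraction determines the tokens inside. *)
Lemma split_solvable X F p s r b Q Q' A a : token_instance k X F p s r b Q -> 1 <= k ->
  a \in A -> A \subset X -> A != X -> ~~ (A \subset Q) -> ~ slack k (cut_demand F p s A) (cut_size F p r b A) ->
  (forall B, B \subset squash A a @: X -> ~~ (B \subset Q') -> ~~ (pullset X (squash A a) B \subset Q)) ->
  (token_instance k (squash A a @: X) F (pushp p (squash A a)) (pushf X (squash A a) s)
     (pushf X (squash A a) r) (pushf X (squash A a) b) Q' ->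
   solvable (squash A a @: X) F (pushp p (squash A a)) (pushf X (squash A a) s) (pushf X (squash A a) b)) ->
  (forall r2 b2, token_instance k A (inner_edges A F p) p s r2 b2 Q ->
     (forall B, B \subset A -> cut_size (inner_edges A F p) p r2 b2 B = cut_size F p r b B) ->
     solvable A (inner_edges A F p) p s b2) ->
  solvable X F p s b.
Proof.
move=> I k1 aA AX AnX AQ nsl hQ h1 h2; have wf := i_wf I.
have [o1 so1] := h1 (inst_push wf I hQ).
have [|o2 so2] := h2 _ _ (inst_res AX I k1 aA AnX AQ nsl so1).
  by move=> B BA; apply: cutw_res.
by exists (fun e => if inside p A e then o2 e else o1 e); exact: (sol_glue aA so1 so2).
Qed.

Lemma inst_exempt X F p s r b Q Q' : Q \subset Q' -> token_instance k X F p s r b Q -> token_instance k X F p s r b Q'.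
Proof.
move=> QQ [wf r0 b0 hf hs hc]; split=> // A AX AnX AQ; apply: hc => //.
by apply: contra AQ => /subset_trans; apply.
Qed.

Definition other_end p z e := if (p e).1 == z then (p e).2 else (p e).1.

Lemma crs1P p z e : crossing p [set z] e ->
  other_end p z e != z /\ (p e = (z, other_end p z e) \/ p e = (other_end p z e, z)).
Proof.
rewrite /crossing /other_end !inE; case: (p e) => x y /=.
case: (altP (x =P z)) => [->|xz] /=; case: (altP (y =P z)) => [->|yz] //= _; split=> //; by [left|right].
Qed.

Lemma subset_card (T : finType) (A : {set T}) n : (n <= #|A|)%N -> exists2 B : {set T}, B \subset A & #|B| = n.
Proof.
move=> nA; exists [set x in take n (enum A)].
  by apply/subsetP=> x; rewrite inE => /mem_take; rewrite mem_enum.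
rewrite cardsE (card_uniqP _) ?take_uniq ?enum_uniq // size_take -cardE.
by case: ltngtP nA.
Qed.

Definition solvable_upto n := forall X F p s r b, (#|X| <= n)%N -> token_instance k X F p s r b set0 -> solvable X F p s b.

Section Drop.
Variables (X : {set V}) (F : {set E}) (p : E -> V * V) (s r b : V -> int) (z u : V).
Hypothesis I : token_instance k X F p s r b [set z].
Hypotheses (zX : z \in X) (uX : u \in X) (uz : u != z).
Hypothesis only_u : forall e, e \in F -> crossing p [set z] e -> other_end p z e = u.

Let X0 := X :\ z.
Let F0 := [set e in F | inside p X0 e].

Lemma drop_cases e : e \in F ->
  [\/ [/\ (p e).1 \in X0, (p e).2 \in X0, inside p X0 e & crossing p [set z] e = false],
      p e = (z, z), p e = (z, u) | p e = (u, z)].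
Proof.
move=> eF; have /andP[e1 e2] := i_wf I eF.
case c: (crossing p [set z] e).
  by have [_] := crs1P c; rewrite (only_u eF c) => -[->|->]; [constructor 3|constructor 4].
move: c; rewrite /inside /crossing !inE e1 e2 !andbT; case: (p e) => x y /=.
case: (altP (x =P z)) => [->|xz] /=; case: (altP (y =P z)) => [->|yz] //= _.
  by constructor 2.
by constructor 1.
Qed.

(** All edges at [z] other than loops go to [u]; half of them, the set [N1], are directed out of
    [z]. The other [h] leave [u], whose requirement drops by [h]. A set containing [u] inherits its
    cut condition from its union with [z], whose demand has the same residue. *)
Lemma drop_solvable n : solvable_upto n -> (#|X| <= n.+1)%N -> r z = 0 -> b z = 0 ->
  balanced F p s r b z -> solvable X F p s b.
Proof.
move=> IH Xn rz bz [h [j []]].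
have zX0 : z \in X0 = false by rewrite !inE eqxx.
have uX0 : u \in X0 by rewrite !inE uz uX.
have zu : z == u = false by rewrite eq_sym (negPf uz).
set N := [set e in F | crossing p [set z] e].
have NF : N \subset F by apply/subsetP=> e; rewrite inE => /andP[].
rewrite /cut_size /cut_demand !isum_set1 rz bz !addr0.
rewrite (eq_isum (g := fun e => (e \in N)%:Z)); last by move=> e eF; rewrite inE eF.
rewrite isum_card // => Nh hz.
have [|N1 N1N N1h] := @subset_card _ N (absz h); first by move: Nh; clear; lia.
have h0 : #|N1|%:Z = h by move: N1h; have := Nh; clear; lia.
have N1F : N1 \subset F by apply: subset_trans NF.
set s0 := fun v => s v - h * (u == v)%:Z.
have sum_s0 B : isum B s0 = isum B s - h * (u \in B)%:Z.
  by rewrite isumB isumZ isum_pt.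
have bigF0 (f : E -> int) : isum F0 f = \sumz_(e in F) (if inside p X0 e then f e else 0).
  exact: isum_filter.
have zB B : B \subset X0 -> z \in B = false.
  by move=> BX; apply/negP => /(subsetP BX); rewrite zX0.
have out0 B : B \subset X0 -> cut_demand F0 p s0 B = cut_demand F p s B - h * (u \in B)%:Z.
  move=> BX; rewrite /cut_demand bigF0 sum_s0.
  rewrite (eq_isum (g := fun e => (inside p B e)%:Z)); first by rewrite addrAC.
  move=> e eF; case: (drop_cases eF) => [[_ _ -> _] //|pe|pe|pe]; by rewrite /inside pe /= ?(zB _ BX) ?zX0 ?andbF.
have out1 B : B \subset X0 -> u \in B -> cut_demand F p s (z |: B) = cut_demand F p s B + s z - \sumz_(e in F) (inside p [set z] e)%:Z - 2 * h.
  move=> BX uB; rewrite /cut_demand isum_setU1 ?(zB _ BX) //=.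
  rewrite (eq_isum (g := fun e => (inside p B e)%:Z + (inside p [set z] e)%:Z + (e \in N)%:Z)).
    by rewrite !isumD isum_card //; move: Nh; clear; lia.
  move=> e eF; rewrite [e \in N]inE eF /=.
  case: (drop_cases eF) => [[p1 p2 i c]|pe|pe|pe].
  - rewrite c /inside; move: p1 p2; rewrite !inE => /andP[/negPf-> _] /andP[/negPf-> _] /=; clear; lia.
  - by rewrite /crossing /inside pe /= !inE !eqxx ?(zB _ BX).
  - by rewrite /crossing /inside pe /= !inE !eqxx ?(zB _ BX) eq_sym zu uB.
  - by rewrite /crossing /inside pe /= !inE !eqxx ?(zB _ BX) eq_sym zu uB.
have cut0 B : B \subset X0 -> u \notin B -> cut_size F0 p r b B = cut_size F p r b B.
  move=> BX uB; rewrite /cut_size bigF0; congr (_ + _ + _); apply: eq_isum => e eF.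
  case: (drop_cases eF) => [[_ _ -> _] //|pe|pe|pe]; by rewrite /inside /crossing pe /= ?(zB _ BX) ?zX0 ?andbF ?(negPf uB).
have cut1 B : B \subset X0 -> u \in B -> cut_size F0 p r b B = cut_size F p r b (z |: B).
  move=> BX uB; rewrite /cut_size bigF0 !isum_setU1 ?(zB _ BX) //= rz bz !add0r; congr (_ + _ + _); apply: eq_isum => e eF.
  case: (drop_cases eF) => [[p1 p2 -> _]|pe|pe|pe].
  - by rewrite /crossing; move: p1 p2; rewrite !inE => /andP[/negPf-> _] /andP[/negPf-> _].
  - by rewrite /crossing /inside pe /= !inE !eqxx ?(zB _ BX).
  - by rewrite /crossing /inside pe /= !inE !eqxx ?(zB _ BX) uB orbT.
  - by rewrite /crossing /inside pe /= !inE !eqxx ?(zB _ BX) uB ?orbT andbF.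
have sumX (f : V -> int) : isum X f = f z + isum X0 f by rewrite (isum_setD1 _ zX).
have zX0X : z |: X0 = X by rewrite setD1K.
have I0 : token_instance k X0 F0 p s0 r b set0.
  have [wf r0 b0 hf [i hi] hc] := I; split=> //.
  - by move=> e; rewrite inE => /andP[_].
  - by move: hf; rewrite !sumX rz bz !add0r.
  - exists (i - j); rewrite out0 // uX0; have := out1 X0 (subxx _) uX0; rewrite zX0X hi sumX bz.
    by move: hz; clear; lia.
  move=> A AX AnX A0; have [uA|uA] := boolP (u \in A); last first.
    rewrite out0 // cut0 // (negPf uA) mulr0 subr0; apply: hc.
    + by apply: subset_trans AX _; apply: subD1set.
    + by apply/eqP => AX'; have := zB _ AX; rewrite AX' zX.
    + apply: contra A0 => AQ; rewrite subset0 -subset0; apply/subsetP => x xA.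
      by have := subsetP AQ _ xA; rewrite inE => /eqP xz; have := zB _ AX; rewrite -xz xA.
  have [||| i' hi'] := hc (z |: A).
  + by rewrite subUset sub1set zX /=; apply: subset_trans AX _; apply: subD1set.
  + apply: contra AnX => /eqP AX'; apply/eqP/setP => x; rewrite /X0 -AX' !inE.
    by case: eqP => //= ->; rewrite (zB _ AX).
  + by apply/negP => /subsetP /(_ u); rewrite !inE uA orbT (negPf uz) => /(_ isT).
  exists (i' - j); rewrite out0 // cut1 // uA; move: hi'; rewrite out1 //; move: hz; clear; lia.
have [o0 so0] : solvable X0 F0 p s0 b by apply: (IH) I0; move: Xn; rewrite (cardsD1 z X) zX.
exists (fun e => if inside p X0 e then o0 e else ((p e).1 == z) == (e \in N1)) => v vX.
set o := (fun e => if _ then _ else _).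
have N1N' e : e \in F -> inside p X0 e -> e \in N1 = false.
  move=> eF ie; apply/negP => /(subsetP N1N); rewrite inE => /andP[_].
  by case: (drop_cases eF) ie => [[_ _ _ ->] //|pe|pe|pe]; rewrite /inside pe /= zX0 ?andbF.
case: (altP (z =P v)) => [<-|zv].
  exists (- j); rewrite bz addr0.
  rewrite (eq_isum (g := fun e => (inside p [set z] e)%:Z + (e \in N1)%:Z)).
    by rewrite isumD isum_card //; move: hz h0; clear; lia.
  move=> e eF; rewrite /tail /o; case: (drop_cases eF) => [[p1 p2 ie c]|pe|pe|pe].
  - rewrite ie (N1N' e) //; move: p1 p2; rewrite /inside !inE => /andP[/negPf n1 _] /andP[/negPf n2 _].
    by rewrite n1 /=; case: (o0 e); rewrite ?n1 ?n2.
  - rewrite /inside pe /= zX0 /= !inE eqxx /=; case eN: (e \in N1) => //=; rewrite ?eqxx //.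
    by have := subsetP N1N _ eN; rewrite inE /crossing pe addbb andbF.
  - rewrite /inside pe /= zX0 /= !inE eqxx (negPf uz) /=; case eN: (e \in N1) => //=; rewrite ?eqxx // (negPf uz) //.
  - rewrite /inside pe /= zX0 /= !inE eqxx (negPf uz) andbF /=; case eN: (e \in N1) => //=; rewrite ?eqxx // (negPf uz) //.
have vX0 : v \in X0 by rewrite !inE vX andbT eq_sym.
have [i hi] := so0 v vX0; exists i.
rewrite (eq_isum (g := fun e => (if inside p X0 e then (tail p o0 e == v)%:Z else 0) +
    (if u == v then (e \in N)%:Z - (e \in N1)%:Z else 0))).
  rewrite isumD -bigF0; move: hi; rewrite /s0.
  case: (u == v); last by move=> hi; rewrite [X in _ + X + _]isum0 //; move: hi; clear; lia.
  by rewrite isumB !isum_card //; move: Nh h0; clear; lia.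
move=> e eF; rewrite [e \in N]inE eF /tail /o; case: (drop_cases eF) => [[p1 p2 ie c]|pe|pe|pe].
- by rewrite ie (N1N' e) // c /=; case: (u == v); rewrite ?subrr ?addr0.
- rewrite /inside pe /= zX0 /= /crossing pe addbb add0r; case eN: (e \in N1).
    by have := subsetP N1N _ eN; rewrite inE /crossing pe addbb andbF.
  by case: (_ == false); rewrite (negPf zv); case: ifP; rewrite ?subrr.
- by rewrite /inside pe /= zX0 /= /crossing pe !inE eqxx (negPf uz) /=; case eN: (e \in N1); rewrite /= ?(negPf zv) ?add0r; case: ifP.
- by rewrite /inside pe /= zX0 andbF /= /crossing pe !inE eqxx (negPf uz) /=; case eN: (e \in N1); rewrite /= ?(negPf zv) ?add0r; case: ifP.
Qed.
End Drop.
End Exempt.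

(** * Splitting off at the exempt vertex *)

Section Lift.
Local Open Scope ring_scope.
Variables (V E : finType) (k : int).
Variables (X : {set V}) (F : {set E}) (p : E -> V * V) (s r b : V -> int) (z : V).
Implicit Types (A : {set V}).
Hypothesis I : token_instance k X F p s r b [set z].
Hypothesis zX : z \in X.
Hypothesis sl : forall A : {set V}, A \subset X -> A != X -> ~~ (A \subset [set z]) -> (1 < #|A|)%N ->
  slack k (cut_demand F p s A) (cut_size F p r b A).

Lemma oth_in e : e \in F -> crossing p [set z] e -> other_end p z e \in X.
Proof. by move=> /(i_wf I) /andP[h1 h2] _; rewrite /other_end; case: ifP. Qed.

Lemma crs_oth A e : crossing p [set z] e -> crossing p A e = (z \in A) (+) (other_end p z e \in A).
Proof. by case/crs1P => _ [pe|pe]; rewrite {1}/crossing pe //= addbC. Qed.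

Lemma inn_oth A e : crossing p [set z] e -> inside p A e = (z \in A) && (other_end p z e \in A).
Proof. by case/crs1P => _ [pe|pe]; rewrite {1}/inside pe //= andbC. Qed.

Lemma not1 A x : x \in A -> x != z -> ~~ (A \subset [set z]).
Proof. by move=> xA xz; apply: contra xz => /subsetP /(_ _ xA); rewrite inE. Qed.

Lemma gt1 A x y : x \in A -> y \in A -> x != y -> (1 < #|A|)%N.
Proof.
move=> xA yA xy; apply: leq_trans (subset_leq_card (_ : [set x; y] \subset A)); first by rewrite cards2 xy.
by apply/subsetP=> v; rewrite !inE => /orP[] /eqP ->.
Qed.

Lemma not1P A : ~~ (A \subset [set z]) -> exists2 x, x \in A & x != z.
Proof. by case/subsetPn => x xA; rewrite inE => xz; exists x. Qed.

Section Pair.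
Variables (e1 e2 : E).
Hypotheses (e1F : e1 \in F) (e2F : e2 \in F) (c1 : crossing p [set z] e1) (c2 : crossing p [set z] e2).
Let u := other_end p z e1.
Let w := other_end p z e2.
Hypothesis uw : u != w.

Let F' := F :\ e2.
(** The name [e1] is reused for the new edge from [u] to [w], and [e2] is deleted. *)
Definition pair_ends e := if e == e1 then (other_end p z e1, other_end p z e2) else p e.
Let p' := pair_ends.
(** The path through [z] that is split off leaves [z] exactly once, in whichever direction it is
    followed. *)
Definition dec_at (v : V) : int := s v - (z == v)%:Z.
Let s' := dec_at.

Lemma pair_sum (f : E -> int) : isum F f = f e2 + (f e1 + isum (F' :\ e1) f).
Proof.
rewrite (isum_setD1 f e2F) (isum_setD1 f (_ : e1 \in F')) // !inE e1F andbT.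
by apply: contra uw => /eqP e12; rewrite /u /w e12.
Qed.

Lemma pair_sum' (f : E -> int) : isum F' f = f e1 + isum (F' :\ e1) f.
Proof. by have := pair_sum f; rewrite (isum_setD1 f e2F) => /addrI. Qed.

Lemma sum_dec A : isum A s' = isum A s - (z \in A)%:Z.
Proof. by rewrite isumB isum_pt. Qed.

Lemma pair_cutw A : cut_size F' p' r b A =
  cut_size F p r b A - 2 * (((u \in A) == (w \in A)) && ((u \in A) != (z \in A)))%:Z.
Proof.
rewrite /cut_size pair_sum pair_sum' (crs_oth A c1) (crs_oth A c2) -/u -/w.
have -> : crossing p' A e1 = (u \in A) (+) (w \in A) by rewrite /crossing /p' /pair_ends eqxx.
have -> : \sumz_(e in F' :\ e1) (crossing p' A e)%:Z = \sumz_(e in F' :\ e1) (crossing p A e)%:Z.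
  by apply: eq_isum => e; rewrite !inE /crossing /p' /pair_ends => /andP[/negPf-> _].
by clear; do 3 case: (_ \in A) => /=; lia.
Qed.

Lemma pair_outw A : cut_demand F' p' s' A =
  cut_demand F p s A - (((u \in A) == (w \in A)) && ((u \in A) != (z \in A)))%:Z.
Proof.
rewrite /cut_demand pair_sum pair_sum' sum_dec (inn_oth A c1) (inn_oth A c2) -/u -/w.
have -> : inside p' A e1 = (u \in A) && (w \in A) by rewrite /inside /p' /pair_ends eqxx.
have -> : \sumz_(e in F' :\ e1) (inside p' A e)%:Z = \sumz_(e in F' :\ e1) (inside p A e)%:Z.
  by apply: eq_isum => e; rewrite !inE /inside /p' /pair_ends => /andP[/negPf-> _].
by clear; do 3 case: (_ \in A) => /=; lia.
Qed.

(** A cut changes only if [A] separates [z] from both [u] and [w]; it then loses two in size and one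
    in demand. Such an [A] contains [u] and [w], or else [z] and, not being exempt, another vertex.
    So it has slack, which absorbs this loss. *)
Lemma pair_inst : token_instance k X F' p' s' r b [set z].
Proof.
have [wf r0 b0 hf [i hi] hc] := I.
have uX := oth_in e1F c1; have wX := oth_in e2F c2.
have [uz _] := crs1P c1; have [wz _] := crs1P c2.
split=> //.
- move=> e; rewrite !inE /p' /pair_ends => /andP[_ eF]; case: eqP => _; last exact: wf.
  by rewrite /= uX wX.
- by exists i; rewrite pair_outw hi uX wX zX /=; clear; lia.
move=> A AX AnX AQ; rewrite pair_outw pair_cutw.
case h: (_ && _); last by have := hc A AX AnX AQ; rewrite mulr0 !subr0.
have [|j hj] := sl AX AnX AQ; last by exists j; move: hj; clear; lia.
case/andP: h => /eqP h1 h2; case uA: (u \in A) h1 h2 => h1 h2.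
  by apply: (gt1 uA (esym h1) uw).
have [x xA xz] := not1P AQ; apply: (gt1 xA _ xz).
by move: h2; case: (z \in A).
Qed.

Lemma pair_bal : balanced k F p s r b z -> balanced k F' p' s' r b z.
Proof.
have [uz _] := crs1P c1; have [wz _] := crs1P c2.
move=> [h [j [h1 h2]]]; exists (h - 1), j; rewrite pair_cutw pair_outw h1 h2 !inE eqxx.
by rewrite (negPf uz) (negPf wz) /=; clear; split; lia.
Qed.

Lemma pair_solvable : solvable k X F' p' s' b -> solvable k X F p s b.
Proof.
case=> o' so.
have [uz pe1] := crs1P c1; have [wz pe2] := crs1P c2.
have e12 : e1 == e2 = false by apply/negP => /eqP e12; move: uw; rewrite /u /w e12 eqxx.
(* The new edge directed from [u] to [w] becomes the path from [u] through [z] to [w], and the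
   opposite direction the reversed path. *)
exists (fun e => if e == e1 then o' e1 == ((p e1).1 != z) else
                 if e == e2 then o' e1 == ((p e2).1 == z) else o' e) => v vX.
set o := (fun e => if _ then _ else _).
have [j hj] := so v vX; exists j; rewrite pair_sum.
have -> : \sumz_(e in F' :\ e1) (tail p o e == v)%:Z = \sumz_(e in F' :\ e1) (tail p' o' e == v)%:Z.
  apply: eq_isum => e; rewrite !inE => /andP[n1 /andP[n2 _]].
  by rewrite /tail /o /p' /pair_ends (negPf n1) (negPf n2).
move: hj; rewrite pair_sum' /s' /dec_at.
have -> : tail p' o' e1 = if o' e1 then u else w by rewrite /tail /p' /pair_ends eqxx.
have -> : tail p o e1 = if o' e1 then u else z.
  rewrite /tail /o eqxx; case: pe1 => ->; rewrite /= ?eqxx ?uz /=; by case: (o' e1).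
have -> : tail p o e2 = if o' e1 then z else w.
  rewrite /tail /o eq_sym e12 eqxx; case: pe2 => ->; rewrite /= ?eqxx ?(negPf wz) /=; by case: (o' e1).
by case: (o' e1); clear; lia.
Qed.
End Pair.

Section Token.
Variables (e1 : E) (c : bool).
Hypotheses (e1F : e1 \in F) (c1 : crossing p [set z] e1).
Let u := other_end p z e1.
Hypothesis tok : 0 < (if c then r z else b z).

Let F' := F :\ e1.
Let s' := dec_at.
(** Splitting off [e1] together with a token at [z] moves the token to the other end of [e1]. The
    token is an [r]-token if [c] holds and a [b]-token otherwise. *)
Definition move_tok (d : bool) (t : V -> int) (v : V) : int :=
  if d then t v + ((other_end p z e1 == v)%:Z - (z == v)%:Z) else t v.
Let r' := move_tok c r.
Let b' := move_tok (~~ c) b.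

Lemma sum_move d t A : isum A (move_tok d t) =
  isum A t + (if d then (u \in A)%:Z - (z \in A)%:Z else 0).
Proof. by rewrite /move_tok; case: d; rewrite ?addr0 // isumD isumB !isum_pt. Qed.

Lemma token_cutw A : cut_size F' p r' b' A = cut_size F p r b A - 2 * ((z \in A) && (u \notin A))%:Z.
Proof.
rewrite /cut_size (isum_setD1 _ e1F) -/F' !sum_move (crs_oth A c1) -/u.
by clear; case: c; do 2 case: (_ \in A) => /=; lia.
Qed.

Lemma token_outw A : cut_demand F' p s' A = cut_demand F p s A - ((z \in A) && (u \notin A))%:Z.
Proof.
rewrite /cut_demand [isum F _](isum_setD1 _ e1F) -/F' sum_dec (inn_oth A c1) -/u.
by clear; lia.
Qed.

Lemma token_inst : token_instance k X F' p s' r' b' [set z].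
Proof.
have [wf r0 b0 hf [i hi] hc] := I.
have uX := oth_in e1F c1; have [uz _] := crs1P c1.
have tok0 (d : bool) (t : V -> int) v : (forall v, 0 <= t v) -> (d -> 0 < t z) -> 0 <= move_tok d t v.
  rewrite /move_tok; case: d => // t0 tz; have := t0 v; case: eqP => _; case: eqP => [<-|_];
  move: (tz isT); clear; lia.
split=> //.
- by move=> e; rewrite !inE => /andP[_]; apply: wf.
- by move=> v; apply: tok0 => // cc; move: tok; rewrite cc.
- by move=> v; apply: tok0 => // cc; move: tok; rewrite (negPf cc).
- by rewrite !sum_move uX zX subrr !if_same !addr0.
- by exists i; rewrite token_outw sum_move hi uX zX subrr if_same /=; clear; lia.
move=> A AX AnX AQ; rewrite token_outw token_cutw.
case h: (_ && _); last by have := hc A AX AnX AQ; rewrite mulr0 !subr0.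
have [|j hj] := sl AX AnX AQ; last by exists j; move: hj; clear; lia.
case/andP: h => zA _; have [x xA xz] := not1P AQ; exact: (gt1 xA zA xz).
Qed.

Lemma token_bal : balanced k F p s r b z -> balanced k F' p s' r' b' z.
Proof.
have [uz _] := crs1P c1.
move=> [h [j [h1 h2]]]; exists (h - 1), j; rewrite token_cutw token_outw h1 h2 !inE eqxx.
by rewrite uz /=; clear; split; lia.
Qed.

Lemma token_solvable : solvable k X F' p s' b' -> solvable k X F p s b.
Proof.
case=> o' so.
have [uz pe1] := crs1P c1.
exists (fun e => if e == e1 then c == ((p e1).1 == z) else o' e) => v vX.
set o := (fun e => if _ then _ else _).
have [j hj] := so v vX; exists j; rewrite (isum_setD1 _ e1F).
have -> : \sumz_(e in F :\ e1) (tail p o e == v)%:Z = \sumz_(e in F') (tail p o' e == v)%:Z.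
  by apply: eq_isum => e; rewrite !inE => /andP[n1 _]; rewrite /tail /o (negPf n1).
move: hj; rewrite /s' /dec_at /b' /move_tok -/u.
have -> : tail p o e1 = if c then z else u.
  rewrite /tail /o eqxx; case: pe1 => ->; rewrite /= ?eqxx ?(negPf uz) /=; by case: c.
by clear; case: c => /=; lia.
Qed.
End Token.
End Lift.

(** * Elimination of the exempt vertex *)

Section Elimination.
Local Open Scope ring_scope.
Variables (V E : finType) (k : int).
Hypothesis k2 : 2 <= k.
Implicit Types (X A : {set V}) (F : {set E}) (p : E -> V * V) (s r b : V -> int) (z : V).

(** With no edges at [z], only tokens leave [X :\ z]. Its admissibility, the sum condition and the
    balance at [z] give [h <= t * k <= k - h] or [h - k <= t * k <= - h], according to the
    alternative in [token_bound]; both exclude [h > 0]. *)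
Lemma isolated_exempt X F p s r b z : token_instance k X F p s r b [set z] -> z \in X -> X != [set z] ->
  (forall e, e \in F -> crossing p [set z] e = false) -> balanced k F p s r b z -> r z = 0 /\ b z = 0.
Proof.
move=> [wf r0 b0 hf [i hi] hc] zX Xz noc [h [j []]].
rewrite {1}/cut_size isum0 ?add0r => [|e eF]; last by rewrite noc.
rewrite /cut_demand !isum_set1 => h1 h2.
have /set0Pn[x xX0] : X :\ z != set0.
  apply: contra Xz => /eqP X0; rewrite eqEsubset sub1set zX andbT; apply/subsetP => y yX.
  by apply/negPn/negP => yz; have := in_set0 y; rewrite -X0 in_setD1 yX; move: yz; rewrite inE => ->.
have [|||l] := hc (X :\ z).
- exact: subD1set.
- by apply/eqP => /setP /(_ z); rewrite !inE eqxx zX.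
- by apply/negP => /subsetP /(_ _ xX0); move: xX0; rewrite !inE => /andP[/negPf->].
have inE' e : e \in F -> (inside p X e)%:Z = (inside p (X :\ z) e)%:Z + (inside p [set z] e)%:Z.
  move=> eF; have /andP[m1 m2] := wf e eF; have := noc e eF; rewrite /crossing /inside !inE m1 m2.
  by case: ((p e).1 == z); case: ((p e).2 == z).
have crs0 : \sumz_(e in F) (crossing p (X :\ z) e)%:Z = 0.
  apply: isum0 => e eF; have /andP[m1 m2] := wf e eF; have := noc e eF; rewrite /crossing !inE m1 m2.
  by case: ((p e).1 == z); case: ((p e).2 == z).
move: hi hf; rewrite /cut_demand /cut_size crs0 !(isum_setD1 _ zX).
have -> : \sumz_(e in F) (inside p X e)%:Z = \sumz_(e in F) (inside p (X :\ z) e)%:Z + \sumz_(e in F) (inside p [set z] e)%:Z.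
  by rewrite -isumD; apply: eq_isum => e eF; exact: inE'.
have := r0 z; have := b0 z; have := @isum_ge0 _ (X :\ z) _ r0; have := @isum_ge0 _ (X :\ z) _ b0.
move: h1 h2 k2; rewrite /token_bound; move: (isum (X :\ z) r) (isum (X :\ z) b) (isum (X :\ z) s) (isum F (fun e => (inside p (X :\ z) e)%:Z))
  (isum F (fun e => (inside p [set z] e)%:Z)) (r z) (b z) (s z).
clear => R B S I1 I2 rz bz sz h1 h2 k2 B0 R0 b0 r0 hi hf hl.
have h0 : h <= 0.
  have [t ht] : exists t, t = i - j - l by exists (i - j - l).
  have ht' : t * k = i * k - j * k - l * k by rewrite ht; clear; lia.
  case: (lerP h 0) => // h_gt0; exfalso; move: hf => [] [hf1 hf2].
    have : h <= t * k <= k - h by move: hi hl h1 h2 hf1 hf2 ht'; clear; lia.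
    case: (lerP t 0) => t0; first by move: t0 h_gt0 k2; clear; nia.
    by move: t0 h_gt0 k2; clear; nia.
  have : h - k <= t * k <= - h by move: hi hl h1 h2 hf1 hf2 ht'; clear; lia.
  case: (lerP 0 t) => t0; first by move: t0 h_gt0 k2; clear; nia.
  by move: t0 h_gt0 k2; clear; nia.
by move: h0 h1 r0 b0; clear; lia.
Qed.

(* A balanced exempt vertex can be eliminated: pairs of edges at it are split
   off as long as no cut without slack forbids it, and at such a cut the
   instance decomposes into two smaller ones. *)
Lemma exempt_solvable n : solvable_upto V E k n ->
  forall m X F p s r b z, z \in X -> (#|X| <= n.+1)%N -> (#|X| + #|F| <= m)%N ->
  token_instance k X F p s r b [set z] -> balanced k F p s r b z -> solvable k X F p s b.
Proof.
move=> IH; elim=> [|m IHm] X F p s r b z zX Xn Xm I hbal.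
  by move: Xm; rewrite leqn0 addn_eq0 cards_eq0 => /andP[/eqP X0]; rewrite X0 inE in zX.
have k1 : 1 <= k by move: k2; clear; lia.
have [Xz|Xz] := eqVneq X [set z].
  exists xpredT => v; rewrite Xz inE => /eqP ->.
  have [i hi] := i_sum I; exists (- i); move: hi; rewrite Xz /cut_demand !isum_set1.
  have -> : \sumz_(e in F) (tail p xpredT e == z)%:Z = \sumz_(e in F) (inside p [set z] e)%:Z.
    apply: eq_isum => e /(i_wf I); rewrite Xz !inE /tail /inside !inE => /andP[/eqP -> /eqP ->].
    by rewrite eqxx.
  by clear; lia.
have [[A [AX AnX AQ A1 nsl]]|nob] := classic (exists A, [/\ A \subset X, A != X, ~~ (A \subset [set z]),
     (1 < #|A|)%N & ~ slack k (cut_demand F p s A) (cut_size F p r b A)]).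
  have AltX : (#|A| < #|X|)%N by apply: proper_card; rewrite properEneq AnX.
  have rF : (#|inner_edges A F p| <= #|F|)%N by apply: subset_leq_card; apply/subsetP=> e; rewrite inE => /andP[].
  (* If [z] lies in [A], the contraction has no exempt vertex and the inside keeps [z]; otherwise
     the roles are exchanged. *)
  have [zA|zA] := boolP (z \in A).
    have sq := card_squash zA AX A1.
    apply: (split_solvable (Q' := set0) I k1 zA AX AnX AQ nsl) => [B BX B0|I1|r2 b2 I2 h2].
    - have [y yB] : exists y, y \in B by apply/set0Pn; rewrite -subset0.
      have /imsetP[x xX yx] := subsetP BX _ yB; move: yB; rewrite yx /squash; case: ifP => xA yB.
        have [x' xA' xz] := not1P AQ; apply: (@not1 _ z _ x') => //.
        by rewrite inE (subsetP AX) // /squash xA'.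
      apply: (@not1 _ z _ x); first by rewrite inE xX /squash xA.
      by apply: contraFN xA => /eqP ->.
    - by apply: IH I1; rewrite -ltnS; apply: leq_trans sq Xn.
    - apply: (IHm _ _ _ _ r2 _ z) => //.
      + by apply: leq_trans (ltnW AltX) Xn.
      + by rewrite -ltnS; apply: leq_trans Xm; rewrite -addSn leq_add.
      case: hbal => h [j [h3 h4]]; exists h, j.
      by rewrite h2 ?sub1set // (outw_res F p s AX) ?sub1set.
  have /card_gt0P[a aA] : (0 < #|A|)%N by apply: ltnW.
  have sq := card_squash aA AX A1.
  have zz : squash A a z = z by rewrite /squash (negPf zA).
  apply: (split_solvable (Q' := [set z]) I k1 aA AX AnX AQ nsl) => [B BX B0|I1|r2 b2 I2 h2].
  - have [y yB yz] := not1P B0.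
    have /imsetP[x xX yx] := subsetP BX _ yB.
    apply: (@not1 _ z _ x); first by rewrite inE xX -yx.
    by apply: contra yz => /eqP xz; rewrite yx xz zz.
  - have pz : pullset X (squash A a) [set z] = [set z].
      apply/setP=> x; rewrite !inE /squash; case: ifP => xA.
        have -> : (x == z) = false by apply/eqP => xz; rewrite -xz xA in zA.
        by rewrite andbC; case: eqP => // az; rewrite -az aA in zA.
      by case: eqP => [->|]; rewrite ?zX ?andbF.
    apply: (IHm _ _ _ _ _ _ z _ _ _ I1).
    + by apply/imsetP; exists z.
    + by apply: leq_trans (ltnW sq) Xn.
    + by rewrite -ltnS; apply: leq_trans Xm; rewrite -addSn leq_add2r.
    case: hbal => h [j [h3 h4]]; exists h, j.
    by rewrite (cutw_push _ (i_wf I)) (outw_push _ (i_wf I)) pz.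
  - apply: (IH _ _ _ _ r2) => //; first by rewrite -ltnS; apply: leq_trans AltX Xn.
    have [wf2 r20 b20 hf2 hs2 hc2] := I2; split=> // B BA BnA B0; apply: hc2 => //.
    have [x xB] : exists x, x \in B by apply/set0Pn; rewrite -subset0.
    apply: (not1 xB); apply: contraNneq zA => <-; exact: (subsetP BA).
have sl A : A \subset X -> A != X -> ~~ (A \subset [set z]) -> (1 < #|A|)%N ->
    slack k (cut_demand F p s A) (cut_size F p r b A).
  by move=> h1 h2 h3 h4; have [//|ns] := classic (slack k (cut_demand F p s A) (cut_size F p r b A)); case: nob; exists A.
have [x xX0 xz] : exists2 x, x \in X & x != z.
  by apply: (@not1P _ z X); apply: contra Xz => Xz; rewrite eqEsubset Xz sub1set.
have [[e1 [e1F c1]]|noc] := classic (exists e, e \in F /\ crossing p [set z] e); last first.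
  have noc' e : e \in F -> crossing p [set z] e = false.
    by move=> eF; apply/negP => c; apply: noc; exists e.
  have [rz bz] := isolated_exempt I zX Xz noc' hbal.
  apply: (drop_solvable I zX xX0 xz _ IH Xn rz bz hbal) => e eF.
  by rewrite noc'.
have FD e : e \in F -> (#|X| + #|F :\ e| <= m)%N.
  by move=> eF; move: Xm; rewrite (cardsD1 e F) eF addnCA add1n ltnS.
have [[e2 [e2F c2 ne]]|noc2] := classic (exists e2, [/\ e2 \in F, crossing p [set z] e2 & other_end p z e1 != other_end p z e2]).
  apply: (pair_solvable e1F e2F c1 c2 ne).
  apply: (IHm _ _ _ _ r _ z) => //; first exact: FD.
    exact: (pair_inst I zX sl e1F e2F c1 c2 ne).
  exact: (pair_bal e1F e2F c1 c2 ne).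
have rb c : 0 < (if c then r z else b z) -> solvable k X F p s b.
  move=> tok; apply: (token_solvable (c := c) e1F c1).
  apply: (IHm _ _ _ _ _ _ z _ _ _ (token_inst I zX sl e1F c1 tok)) => //; first exact: FD.
  exact: token_bal.
have [/(rb true)//|rz] := ltrP 0 (r z); have [/(rb false)//|bz] := ltrP 0 (b z).
(* Nothing is left to split off: the edges at [z] all lead to one vertex, and [z] carries no
   token. *)
apply: (drop_solvable I zX (oth_in I e1F c1) _ _ IH Xn _ _ hbal).
- by have [] := crs1P c1.
- by move=> e eF c; apply/eqP; rewrite eq_sym; apply/negPn/negP => ne; apply: noc2; exists e.
- by apply/eqP; rewrite eq_le rz (i_r I).
- by apply/eqP; rewrite eq_le bz (i_b I).
Qed.
End Elimination.

(** Excluded middle turns properties that are not boolean, such as [in_ok], into finite sets. *)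
Lemma classic_set (T : finType) (P : T -> Prop) : exists A : {set T}, forall v, v \in A <-> P v.
Proof.
suff [A hA] : exists A : {set T}, forall v, v \in enum T -> (v \in A <-> P v).
  by exists A => v; apply: hA; rewrite mem_enum.
elim: (enum T) => [|x s [A hA]]; first by exists set0.
have [Px|nPx] := classic (P x).
  exists (x |: A) => v; rewrite in_cons !inE; case: eqP => [-> _|_ /= /hA] //.
exists (A :\ x) => v; rewrite in_cons !inE; case: eqP => [-> _|_ /= /hA] //.
Qed.

(** * The induction for modular orientations *)

Section Main.
Local Open Scope ring_scope.
Variables (V E : finType) (k : int).
Hypothesis k2 : 2 <= k.
Implicit Types (X A : {set V}) (F : {set E}) (p : E -> V * V) (s r b : V -> int) (v x y : V).

Lemma ok_eq (w w' d d' : int) : w = w' -> d = d' -> admissible k w d -> admissible k w' d'.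
Proof. by move=> -> ->. Qed.

(* The token bound prevents [z0] from being a cut vertex. *)
Lemma inst_crossing X F p s r b A : token_instance k X F p s r b set0 -> A \subset X -> A != set0 -> A != X ->
  exists2 e, e \in F & crossing p A e.
Proof.
move=> [wf r0 b0 hf [i hi] hc] AX A0 AnX.
have [[e [eF c]]|noc] := classic (exists e, e \in F /\ crossing p A e); first by exists e.
exfalso; have nc e : e \in F -> crossing p A e = false.
  by move=> eF; apply/negP => c; apply: noc; exists e.
have [|j1 h1] := hc A AX AnX; first by rewrite subset0.
have [|||j2 h2] := hc (X :\: A).
- exact: subsetDl.
- apply: contra A0 => /eqP h; apply/eqP/setP => v; rewrite inE; apply/negP => vA.
  by have := subsetP AX _ vA; rewrite -h inE vA.
- rewrite subset0; apply: contra AnX => /eqP h; rewrite eqEsubset AX; apply/subsetP => v vX.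
  by apply/negPn/negP => vA; have := in_set0 v; rewrite -h inE vX vA.
have sumX (f : V -> int) : isum X f = isum A f + isum (X :\: A) f.
  by rewrite /isum (big_setID A) /= (setIidPr AX).
have c1 : \sumz_(e in F) (crossing p A e)%:Z = 0 by apply: isum0 => e eF; rewrite nc.
have c2 : \sumz_(e in F) (crossing p (X :\: A) e)%:Z = 0.
  apply: isum0 => e eF; have /andP[m1 m2] := wf e eF; have := nc e eF; rewrite /crossing !inE m1 m2.
  by case: (_ \in A); case: (_ \in A).
have ie : \sumz_(e in F) (inside p X e)%:Z = \sumz_(e in F) (inside p A e)%:Z + \sumz_(e in F) (inside p (X :\: A) e)%:Z.
  rewrite -isumD; apply: eq_isum => e eF; have /andP[m1 m2] := wf e eF; have := nc e eF.
  by rewrite /crossing /inside !inE m1 m2; case: (_ \in A); case: (_ \in A).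
move: hi h1 h2 hf; rewrite /cut_demand /cut_size c1 c2 ie !sumX /token_bound.
move: (isum A r) (isum A b) (isum A s) (isum (X :\: A) r) (isum (X :\: A) b) (isum (X :\: A) s)
  (\sumz_(e in F) (inside p A e)%:Z) (\sumz_(e in F) (inside p (X :\: A) e)%:Z) k2.
clear => R1 B1 S1 R2 B2 S2 I1 I2 k2 hi h1 h2 hf.
have [t ht] : exists t, t = i - j1 - j2 by exists (i - j1 - j2).
have ht' : t * k = i * k - j1 * k - j2 * k by rewrite ht; clear; lia.
(* With no edge between them, the demands of [A] and [X :\: A] add up to that of [X]. Adding the two
   admissibility conditions contradicts the token bound. *)
have h3 : 2 * k - 2 <= B1 + B2 + t * k <= R1 + R2 + B1 + B2 - 2 * k + 2.
  by move: ht' hi h1 h2; clear; lia.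
case: hf => [] [f1 f2].
  case: (lerP t 0) => t0; move: h3 f1 f2 t0 k2; clear; nia.
case: (lerP 0 t) => t0; move: h3 f1 f2 t0 k2; clear; nia.
Qed.

Section Delete.
Variables (X : {set V}) (F : {set E}) (p : E -> V * V) (s r b : V -> int).
Variables (e : E) (x y : V) (t t' : int).
Hypotheses (eF : e \in F) (xy : x != y) (pe : p e = (x, y) \/ p e = (y, x)).

Definition add_at (a : int) v (f : V -> int) (u : V) : int := f u + a * (v == u)%:Z.

Lemma sum_add a v f A : isum A (add_at a v f) = isum A f + a * (v \in A)%:Z.
Proof. by rewrite isumD isumZ isum_pt. Qed.

Let s1 := add_at (-1) x (add_at t y s).

(** The edge is oriented from [x] to [y] and deleted, while [t'] tokens into [x] and [t] tokens out
    of [y] are added. Larger sets have slack for the lost edge and other singletons do not change,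
    so only [x] and [y] are left to check. *)
Lemma del_inst : token_instance k X F p s r b set0 -> 0 <= t -> 0 <= t' ->
  (forall A, A \subset X -> A != X -> (1 < #|A|)%N -> slack k (cut_demand F p s A) (cut_size F p r b A)) ->
  token_bound k (isum X r + t') (isum X b + t) ->
  admissible k (cut_demand F p s [set x] - 1) (cut_size F p r b [set x] - 1 + t') ->
  admissible k (cut_demand F p s [set y] + t) (cut_size F p r b [set y] - 1 + t) ->
  token_instance k X (F :\ e) p s1 (add_at t' x r) (add_at t y b) set0.
Proof.
move=> [wf r0 b0 hf [i hi] hc] t0 t0' sl hfew okx oky.
have crsE A : crossing p A e = (x \in A) (+) (y \in A) by rewrite {1}/crossing; case: pe => -> //=; rewrite addbC.
have innE A : inside p A e = (x \in A) && (y \in A) by rewrite {1}/inside; case: pe => -> //=; rewrite andbC.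
have cutE A : cut_size (F :\ e) p (add_at t' x r) (add_at t y b) A =
    cut_size F p r b A - ((x \in A) (+) (y \in A))%:Z + t' * (x \in A)%:Z + t * (y \in A)%:Z.
  by rewrite /cut_size (isum_setD1 _ eF) crsE !sum_add; clear; lia.
have outE A : cut_demand (F :\ e) p s1 A =
    cut_demand F p s A - (x \in A)%:Z + t * (y \in A)%:Z + ((x \in A) && (y \in A))%:Z.
  by rewrite /cut_demand (isum_setD1 _ eF) innE !sum_add; clear; lia.
have /andP[xX yX] : (x \in X) && (y \in X) by have := wf e eF; case: pe => -> //=; rewrite andbC.
split.
- by move=> e'; rewrite !inE => /andP[_]; apply: wf.
- by move=> v; have := r0 v; move: t0'; rewrite /add_at; case: (x == v); clear; lia.
- by move=> v; have := b0 v; move: t0; rewrite /add_at; case: (y == v); clear; lia.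
- by rewrite !sum_add xX yX !mulr1.
- by exists i; rewrite outE sum_add xX yX hi /=; clear; lia.
move=> A AX AnX A0; rewrite outE cutE.
have [A1|A1] := ltnP 1 #|A|.
  have [j hj] := sl A AX AnX A1; exists j.
  by move: hj t0 t0'; case: (x \in A); case: (y \in A); clear; lia.
have /cards1P[v Av] : #|A| == 1%N by rewrite eqn_leq A1 /= card_gt0 -subset0.
rewrite Av !inE; case: (altP (x =P v)) => [<-|xv].
  by rewrite eq_sym (negPf xy); apply: ok_eq okx => /=; clear; lia.
case: (altP (y =P v)) => [<-|yv]; first by apply: ok_eq oky => /=; clear; lia.
by rewrite -Av; apply: ok_eq (hc A AX AnX A0) => /=; clear; lia.
Qed.

Lemma del_solvable : solvable k X (F :\ e) p s1 (add_at t y b) -> solvable k X F p s b.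
Proof.
case=> o' so; exists (fun e' => if e' == e then (p e).1 == x else o' e') => v vX.
set o := (fun e => if _ then _ else _).
have [j hj] := so v vX; exists j; rewrite (isum_setD1 _ eF).
have -> : \sumz_(e' in F :\ e) (tail p o e' == v)%:Z = \sumz_(e' in F :\ e) (tail p o' e' == v)%:Z.
  by apply: eq_isum => e'; rewrite !inE => /andP[n1 _]; rewrite /tail /o (negPf n1).
have -> : tail p o e = x.
  by rewrite /tail /o eqxx; case: pe => -> /=; rewrite ?eqxx // eq_sym (negPf xy).
by move: hj; rewrite /s1 /add_at; clear; lia.
Qed.
End Delete.

Section Untoken.
Variables (X : {set V}) (F : {set E}) (p : E -> V * V) (s r b : V -> int) (c : bool) (v : V).

Let s1 := add_at (if c then 0 else -1) v s.
Let r1 := add_at (if c then -1 else 0) v r.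
Let b1 := add_at (if c then 0 else -1) v b.

(** A removed token costs a cut one in size and, if it is a [b]-token, one in demand. Sets of
    several vertices have slack for this, so only [v] itself is left to check. *)
Lemma untoken_inst : token_instance k X F p s r b set0 -> v \in X -> 0 < (if c then r v else b v) ->
  (forall A, A \subset X -> A != X -> (1 < #|A|)%N -> slack k (cut_demand F p s A) (cut_size F p r b A)) ->
  admissible k (cut_demand F p s [set v] - (~~ c)%:Z) (cut_size F p r b [set v] - 1) ->
  token_instance k X F p s1 r1 b1 set0.
Proof.
move=> [wf r0 b0 hf [i hi] hc] vX tok sl okv.
have cutE A : cut_size F p r1 b1 A = cut_size F p r b A - (v \in A)%:Z.
  by rewrite /cut_size !sum_add; clear; case: c; lia.
have outE A : cut_demand F p s1 A = cut_demand F p s A - ((~~ c) && (v \in A))%:Z.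
  by rewrite /cut_demand !sum_add; clear; case: c; lia.
split=> //.
- move=> u; have := r0 u; rewrite /r1 /add_at; case: eqP => [<-|_]; last by clear; lia.
  by move: tok; case: c; clear; lia.
- move=> u; have := b0 u; rewrite /b1 /add_at; case: eqP => [<-|_]; last by clear; lia.
  by move: tok; case: c; clear; lia.
- by move: hf; rewrite /token_bound !sum_add vX; clear; case: c; lia.
- by exists i; rewrite outE sum_add vX hi; clear; case: c; lia.
move=> A AX AnX A0; rewrite outE cutE.
have [A1|A1] := ltnP 1 #|A|.
  have [j hj] := sl A AX AnX A1; exists j.
  by move: hj; case: (v \in A); clear; case: c; lia.
have /cards1P[u Au] : #|A| == 1%N by rewrite eqn_leq A1 /= card_gt0 -subset0.
rewrite Au !inE; case: (altP (v =P u)) => [<-|vu]; first by rewrite andbT.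
by rewrite andbF -Au; apply: ok_eq (hc A AX AnX A0) => /=; clear; lia.
Qed.

Lemma untoken_solvable : solvable k X F p s1 b1 -> solvable k X F p s b.
Proof.
case=> o so; exists o => u uX; have [j hj] := so u uX; exists j.
by move: hj; rewrite /s1 /b1 /add_at; clear; lia.
Qed.

Lemma untoken_sum : v \in X -> isum X r1 + isum X b1 = isum X r + isum X b - 1.
Proof. by move=> vX; rewrite !sum_add vX; clear; case: c; lia. Qed.
End Untoken.

Lemma crs_endsP A p e : crossing p A e ->
  exists x y, [/\ x \in A, y \notin A & p e = (x, y) \/ p e = (y, x)].
Proof.
rewrite /crossing; case: (p e) => x y /=.
have [xA|xA] := boolP (x \in A); have [yA|yA] := boolP (y \in A) => //= _.
  by exists x, y; split=> //; left.
by exists y, x; split=> //; right.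
Qed.


(** On a single vertex all edges are loops, so the out-degree is determined, and the sum condition
    says that it is the required one. *)
Lemma small_solvable X F p s r b Q : token_instance k X F p s r b Q -> (#|X| <= 1)%N -> solvable k X F p s b.
Proof.
move=> I X1; exists xpredT => v vX.
have Xv : X = [set v] by apply/esym/eqP; rewrite eqEcard sub1set vX cards1.
have [i hi] := i_sum I; exists (- i); move: hi; rewrite Xv /cut_demand !isum_set1.
have -> : \sumz_(e in F) (tail p xpredT e == v)%:Z = \sumz_(e in F) (inside p [set v] e)%:Z.
  apply: eq_isum => e /(i_wf I); rewrite Xv !inE /tail /inside !inE => /andP[/eqP -> /eqP ->].
  by rewrite eqxx.
by clear; lia.
Qed.

Lemma squash_solvable n X F p s r b A : solvable_upto V E k n -> (#|X| <= n.+1)%N -> token_instance k X F p s r b set0 ->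
  A \subset X -> A != X -> (1 < #|A|)%N -> ~ slack k (cut_demand F p s A) (cut_size F p r b A) ->
  solvable k X F p s b.
Proof.
move=> IH Xn I AX AnX A1 nsl; have k1 : 1 <= k by move: k2; clear; lia.
have /card_gt0P[a aA] : (0 < #|A|)%N by apply: ltnW.
have AltX : (#|A| < #|X|)%N by apply: proper_card; rewrite properEneq AnX.
have A0 : ~~ (A \subset set0) by apply/negP => /subsetP /(_ _ aA); rewrite inE.
apply: (split_solvable (Q' := set0) I k1 aA AX AnX A0 nsl) => [B BX B0|I1|r2 b2 I2 h2].
- have [y yB] : exists y, y \in B by apply/set0Pn; rewrite -subset0.
  have /imsetP[x xX yx] := subsetP BX _ yB.
  by rewrite subset0; apply/set0Pn; exists x; rewrite inE xX -yx.
- by apply: IH I1; rewrite -ltnS; apply: leq_trans (card_squash aA AX A1) Xn.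
- by apply: IH I2; rewrite -ltnS; apply: leq_trans AltX Xn.
Qed.

(* The conditions under which an edge may be deleted after orienting it out of,
   respectively into, a vertex with data [w] and [d]. *)
Definition out_ok (w d : int) := exists j : int, k <= w - j * k <= d - k + 1.
Definition in_ok (w d : int) := exists j : int, k - 1 <= w - j * k <= d - k.

(* When no edge can be oriented and deleted, no vertex accepts an incoming edge
   or none accepts an outgoing one.  In the first case [b]-tokens can be
   removed; once there are none, adding [3 k - 2 - d y <= k - 1] of them at [y]
   makes [y] accept an incoming edge.  The second case is symmetric. *)
Lemma main_step n : solvable_upto V E k n -> solvable_upto V E k n.+1.
Proof.
move=> IH; have k1 : 1 <= k by move: k2; clear; lia.
suff H m : forall t X F p s r b, (#|X| <= n.+1)%N -> #|F| = m -> absz (isum X r + isum X b)%R = t ->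
    token_instance k X F p s r b set0 -> solvable k X F p s b.
  by move=> X F p s r b Xn; apply: (H #|F| _ _ _ _ _ r _ Xn (erefl _) (erefl _)).
(* The induction is lexicographic, on edges first and then on tokens, because the deletion of an
   edge may create tokens. *)
elim/ltn_ind: m => m IHm; elim/ltn_ind => t IHt X F p s r b Xn Fm Xt I.
have [X1|X1] := leqP #|X| 1; first exact: small_solvable I X1.
have [[A [AX AnX A1 nsl]]|nob] := classic (exists A, [/\ A \subset X, A != X,
     (1 < #|A|)%N & ~ slack k (cut_demand F p s A) (cut_size F p r b A)]).
  exact: squash_solvable IH Xn I AX AnX A1 nsl.
have sl A : A \subset X -> A != X -> (1 < #|A|)%N -> slack k (cut_demand F p s A) (cut_size F p r b A).
  by move=> h1 h2 h3; have [//|ns] := classic (slack k (cut_demand F p s A) (cut_size F p r b A)); case: nob; exists A.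
pose w v := cut_demand F p s [set v]; pose d v := cut_size F p r b [set v].
have okv v : v \in X -> admissible k (w v) (d v).
  move=> vX; apply: (i_cut I); rewrite ?sub1set //.
    by apply: contraTneq X1 => <-; rewrite cards1.
  by rewrite inE.
(* Such a [z] is balanced with [h = k - 1], so it may be exempted and eliminated. Every other vertex
   satisfies [out_ok] or [in_ok]. *)
have [[z [zX dz [j wz]]]|noz] := classic (exists z, [/\ z \in X, d z = 2 * (k - 1) & exists j, w z = k - 1 + j * k]).
  apply: (exempt_solvable k2 IH zX Xn (leqnn _) (inst_exempt (sub0set [set z]) I)).
  by exists (k - 1), j.
have nz v : v \in X -> out_ok (w v) (d v) \/ in_ok (w v) (d v).
  move=> vX; have [j hj] := okv v vX.
  have [y1|y1] := lerP k (w v - j * k); first by left; exists j; move: hj y1; clear; lia.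
  have [y2|y2] := lerP (w v - j * k) (d v - k); first by right; exists j; move: hj y2; clear; lia.
  by case: noz; exists v; split=> //; last (exists j); move: hj y1 y2; clear; lia.
have FD e : e \in F -> (#|F :\ e| < m)%N by move=> eF; rewrite -Fm (cardsD1 e F) eF.
have del e x y a a' : e \in F -> x != y -> p e = (x, y) \/ p e = (y, x) -> 0 <= a -> 0 <= a' ->
    token_bound k (isum X r + a') (isum X b + a) -> admissible k (w x - 1) (d x - 1 + a') ->
    admissible k (w y + a) (d y - 1 + a) -> solvable k X F p s b.
  move=> eF xy pe a0 a0' hfew okx oky; apply: (del_solvable eF xy pe (t := a)).
  by apply: (IHm _ (FD _ eF)) (del_inst eF xy pe I a0 a0' sl hfew okx oky).
have del0 e x y : e \in F -> x != y -> p e = (x, y) \/ p e = (y, x) ->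
    out_ok (w x) (d x) -> in_ok (w y) (d y) -> solvable k X F p s b.
  move=> eF xy pe [j1 h1] [j2 h2]; apply: (del e x y 0 0 eF xy pe) => //.
  - by rewrite !addr0; apply: i_few I.
  - by exists j1; move: h1; clear; lia.
  - by exists j2; move: h2; clear; lia.
have untok c v : v \in X -> 0 < (if c then r v else b v) -> admissible k (w v - (~~ c)%:Z) (d v - 1) ->
    solvable k X F p s b.
  move=> vX tok okw; apply: (untoken_solvable (c := c) (v := v)).
  apply: (IHt _ _ _ _ _ _ _ _ Xn Fm (erefl _) (untoken_inst I vX tok sl okw)).
  rewrite untoken_sum // -Xt; have := isum_ge0 X (i_r I); have := isum_ge0 X (i_b I).
  have := isum_setD1 r vX; have := isum_setD1 b vX.
  have := isum_ge0 (X :\ v) (i_r I); have := isum_ge0 (X :\ v) (i_b I).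
  have := i_r I v; have := i_b I v; move: tok.
  move: (isum X r) (isum X b) (isum (X :\ v) r) (isum (X :\ v) b) (r v) (b v).
  by clear; case: c; lia.
have [x0 x0X] : exists x, x \in X by apply/set0Pn; rewrite -card_gt0; apply: ltnW.
have cross A : A \subset X -> A != set0 -> A != X ->
    exists e x y, [/\ e \in F, x \in A, y \in X :\: A & p e = (x, y) \/ p e = (y, x)].
  move=> AX A0 AnX; have [e eF c] := inst_crossing I AX A0 AnX.
  have [x [y [xA yA pe]]] := crs_endsP c; exists e, x, y; split=> //.
  by rewrite inE yA; have := i_wf I eF; case: pe => -> /= /andP[].
(* By connectivity, a property that holds somewhere in [X] holds on all of [X] unless an edge joins
   a vertex with it to one without it. *)
have allP (P : V -> Prop) : (forall e x y, e \in F -> x != y -> p e = (x, y) \/ p e = (y, x) ->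
    x \in X -> y \in X -> P x -> ~ P y -> solvable k X F p s b) ->
    (exists2 x, x \in X & P x) -> solvable k X F p s b \/ forall x, x \in X -> P x.
  move=> hP [x xX Px]; have [A hA] := classic_set (fun v => v \in X /\ P v).
  have [AX|AnX] := eqVneq A X; first by right=> y; rewrite -{1}AX => /hA[].
  left; have [||e [u [v [eF uA]]]] := cross A _ _ AnX.
  - by apply/subsetP=> v /hA[].
  - by apply/set0Pn; exists x; apply/hA.
  have /hA[uX Pu] := uA; rewrite inE => /andP[vA vX] pe.
  apply: (hP e u v) => //; first by apply: contraNneq vA => <-.
  by move=> Pv; case/negP: vA; apply/hA.
have cross1 x : x \in X -> exists e y, [/\ e \in F, x != y, y \in X & p e = (x, y) \/ p e = (y, x)].
  move=> xX; have [|||e [u [y [eF]]]] := cross [set x]; rewrite ?sub1set //.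
  - by apply/set0Pn; exists x; rewrite inE.
  - by apply: contraTneq X1 => <-; rewrite cards1.
  rewrite !inE => /eqP -> /andP[yx yX] pe; exists e, y; split=> //; by rewrite eq_sym.
have [exP|noP] := classic (exists2 x, x \in X & ~ in_ok (w x) (d x)).
  have [|//|aP] := @allP (fun x => ~ in_ok (w x) (d x)) _ exP.
    move=> e x y eF xy pe xX yX Px /NNPP; apply: (del0 e x y eF xy pe).
    by case: (nz x xX).
  have dP v : v \in X -> exists2 j, w v = d v - k + 1 + j * k & 2 * k - 1 <= d v < 3 * k - 2.
    move=> vX; have nin := aP v vX; have [[j hj]|//] := nz v vX; exists j.
      have [y2|y2] := lerP (w v - j * k) (d v - k); first by case: nin; exists j; move: hj y2; clear; lia.
      by move: hj y2; clear; lia.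
    have h1 : ~ (k - 1 <= w v - j * k <= d v - k) by move=> h; apply: nin; exists j.
    have h2 : ~ (k - 1 <= w v - (j + 1) * k <= d v - k) by move=> h; apply: nin; exists (j + 1).
    by move: hj h1 h2 k1; clear; lia.
  have [[v [vX bv]]|nob'] := classic (exists v, v \in X /\ 0 < b v).
    apply: (untok false v vX bv); have [[j hj]|/aP//] := nz v vX.
    by exists j; move: hj; rewrite /=; clear; lia.
  have b0 : isum X b = 0.
    apply: isum0 => v vX; apply/eqP; rewrite eq_le (i_b I) andbT leNgt; apply/negP => bv.
    by apply: nob'; exists v.
  have [e [y [eF xy yX pe]]] := cross1 x0 x0X.
  have [j1 w1 d1] := dP x0 x0X; have [j2 w2 d2] := dP y yX.
  apply: (del e x0 y (3 * k - 2 - d y) 0 eF xy pe) => //.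
  - by move: d2; clear; lia.
  - rewrite b0; move: (i_few I) d2; rewrite /token_bound b0; clear; lia.
  - by exists j1; move: w1 d1 k2; clear; lia.
  (* The demand of [y] is now [k - 1] modulo [k], and its size is [3 * k - 3]. *)
  - by exists (j2 + 1); move: w2 d2 k2; clear; lia.
have [exN|noN] := classic (exists2 x, x \in X & ~ out_ok (w x) (d x)).
  have [|//|aN] := @allP (fun x => ~ out_ok (w x) (d x)) _ exN.
    move=> e x y eF xy pe xX yX Px /NNPP Py; apply: (del0 e y x eF) => //; first by rewrite eq_sym.
      by case: pe; [right|left].
    by case: (nz x xX).
  have dN v : v \in X -> exists2 j, w v = k - 1 + j * k & 2 * k - 1 <= d v < 3 * k - 2.
    move=> vX; have nout := aN v vX; have [//|[j hj]] := nz v vX; exists j.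
      have [y2|y2] := lerP k (w v - j * k); first by case: nout; exists j; move: hj y2; clear; lia.
      by move: hj y2; clear; lia.
    have h1 : ~ (k <= w v - j * k <= d v - k + 1) by move=> h; apply: nout; exists j.
    have h2 : ~ (k <= w v - (j - 1) * k <= d v - k + 1) by move=> h; apply: nout; exists (j - 1).
    by move: hj h1 h2 k1; clear; lia.
  have [[v [vX rv]]|nor] := classic (exists v, v \in X /\ 0 < r v).
    apply: (untok true v vX rv); have [/aN//|[j hj]] := nz v vX.
    by exists j; move: hj; rewrite /=; clear; lia.
  have r0 : isum X r = 0.
    apply: isum0 => v vX; apply/eqP; rewrite eq_le (i_r I) andbT leNgt; apply/negP => rv.
    by apply: nor; exists v.
  have [e [y [eF xy yX pe]]] := cross1 x0 x0X.
  have [j1 w1 d1] := dN x0 x0X; have [j2 w2 d2] := dN y yX.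
  apply: (del e x0 y 0 (3 * k - 2 - d x0) eF xy pe) => //.
  - by move: d1; clear; lia.
  - rewrite r0; move: (i_few I) d1; rewrite /token_bound r0; clear; lia.
  - by exists (j1 - 1); move: w1 d1 k2; clear; lia.
  - by exists j2; move: w2 d2 k2; clear; lia.
have [e [y [eF xy yX pe]]] := cross1 x0 x0X.
apply: (del0 e x0 y eF xy pe).
  by have [//|h] := classic (out_ok (w x0) (d x0)); case: noN; exists x0.
by have [//|h] := classic (in_ok (w y) (d y)); case: noP; exists y.
Qed.

Lemma modular_orientation X F p s r b : token_instance k X F p s r b set0 -> solvable k X F p s b.
Proof.
have H n : solvable_upto V E k n.
  elim: n => [|n IHn]; last exact: main_step.
  by move=> Y F' p' s' r' b' Y0 I; apply: small_solvable I (leq_trans Y0 _).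
exact: (H #|X|).
Qed.
End Main.

(** * Packing two spanning trees *)
Section Connectivity.
Variables (V E : finType).
Implicit Types (p : E -> V * V) (T S F : {set E}) (x y a b : V) (e f g : E).

Definition adj p T : rel V := fun x y => [exists e in T, (p e == (x, y)) || (p e == (y, x))].
Definition linked p T : rel V := connect (adj p T).

Lemma adjP p T x y : reflect (exists2 e, e \in T & p e = (x, y) \/ p e = (y, x)) (adj p T x y).
Proof.
apply: (iffP exists_inP) => -[e eT h]; exists e => //.
  by case/orP: h => /eqP; [left|right].
by case: h => ->; rewrite eqxx ?orbT.
Qed.

Lemma cnC p T x y : linked p T x y = linked p T y x.
Proof.
apply: sym_connect_sym => u v.
by apply/adjP/adjP => -[e eT h]; exists e => //; case: h; [right|left|right|left].
Qed.

Lemma cn_refl p T x : linked p T x x. Proof. exact: connect0. Qed.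

Lemma cn_trans p T y x z : linked p T x y -> linked p T y z -> linked p T x z.
Proof. exact: connect_trans. Qed.

Lemma cn_edge p T e : e \in T -> linked p T (p e).1 (p e).2.
Proof. by move=> eT; apply: connect1; apply/adjP; exists e => //; left; case: (p e). Qed.

Lemma cn_le p p' T S : (forall e, e \in S -> linked p T (p' e).1 (p' e).2) ->
  forall x y, linked p' S x y -> linked p T x y.
Proof.
move=> h; apply: connect_sub => x y /adjP[e eS pe].
by have := h e eS; case: pe => -> //=; rewrite cnC.
Qed.

Lemma cn_sub p T S x y : S \subset T -> linked p S x y -> linked p T x y.
Proof. by move=> ST; apply: cn_le => e /(subsetP ST); apply: cn_edge. Qed.

Lemma cn_add p T e x y : linked p (e |: T) x y ->
  [\/ linked p T x y, linked p T x (p e).1 /\ linked p T (p e).2 y | linked p T x (p e).2 /\ linked p T (p e).1 y].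
Proof.
case/connectP => l; elim: l x => [|x1 l IH] x /=; first by move=> _ ->; constructor; apply: cn_refl.
case/andP => /adjP[g gT pg] hl hy; have {IH} := IH x1 hl hy.
move: gT; rewrite !inE => /orP[/eqP ge|gT].
  rewrite -ge; case: pg => -> /=.
  - case=> [h|[h1 h2]|[h1 h2]].
    + by constructor 2; split=> //; apply: cn_refl.
    + by constructor 2; split=> //; apply: cn_refl.
    + by constructor 1.
  - case=> [h|[h1 h2]|[h1 h2]].
    + by constructor 3; split=> //; apply: cn_refl.
    + by constructor 1.
    + by constructor 3; split=> //; apply: cn_refl.
have xx1 : linked p T x x1 by apply: connect1; apply/adjP; exists g.
case=> [h|[h1 h2]|[h1 h2]].
- by constructor 1; apply: cn_trans h.
- by constructor 2; split=> //; apply: cn_trans h1.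
- by constructor 3; split=> //; apply: cn_trans h1.
Qed.

Definition acyc p T := [forall e in T, ~~ linked p (T :\ e) (p e).1 (p e).2].

Lemma acycP p T : reflect (forall e, e \in T -> ~~ linked p (T :\ e) (p e).1 (p e).2) (acyc p T).
Proof. exact: forall_inP. Qed.

Lemma acyc_sub p T S : S \subset T -> acyc p T -> acyc p S.
Proof.
move=> ST /acycP h; apply/acycP => e eS; have := h e (subsetP ST _ eS).
by apply: contra; apply: cn_sub; apply: setSD.
Qed.

Lemma acyc_add p T e : acyc p T -> e \notin T -> ~~ linked p T (p e).1 (p e).2 -> acyc p (e |: T).
Proof.
move=> /acycP aT eT ne; apply/acycP => g; rewrite !inE => /orP[/eqP ->|gT]; first by rewrite setU1K.
have ge : g != e by apply: contraNneq eT => <-.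
have -> : (e |: T) :\ g = e |: (T :\ g).
  by apply/setP=> f; rewrite !inE; case: (eqVneq f e) => [->|] //=; rewrite eq_sym ge.
have sub : T :\ g \subset T by apply: subD1set.
have gg := cn_edge p gT; rewrite cnC in gg.
apply/negP => /cn_add[|[h1 h2]|[h1 h2]]; first exact/negP/aT.
  case/negP: ne; rewrite cnC; apply: cn_trans (cn_sub sub h2) _.
  by apply: cn_trans gg (cn_sub sub h1).
case/negP: ne; apply: cn_trans (cn_sub sub h2) _.
by apply: cn_trans gg (cn_sub sub h1).
Qed.

Definition bridges p T x y := [set g in T | ~~ linked p (T :\ g) x y].

(** In a forest these edges form the path from [x] to [y]. In a minimal linking set [M], an edge
    whose deletion from [T] leaves [x] and [y] linked would have its own ends linked in [T] without
    it. *)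
Lemma cn_bridges p T x y : acyc p T -> linked p T x y -> linked p (bridges p T x y) x y.
Proof.
move=> /acycP aT cT.
have [M /minsetP[cM minM] MT] := @minset_exists _ (fun S => linked p S x y) T cT.
apply: (cn_sub _ cM); apply/subsetP => g gM; rewrite inE (subsetP MT) //=.
apply/negP => cg; have gT := subsetP MT _ gM.
have ncM : ~~ linked p (M :\ g) x y.
  apply/negP => h; have /setP/(_ g) := minM _ h (subD1set _ _).
  by rewrite gM !inE eqxx.
have sub : M :\ g \subset T :\ g by apply: setSD.
have := cM; rewrite -{1}(setD1K gM) => /cn_add[h|[h1 h2]|[h1 h2]].
- by rewrite h in ncM.
- case/negP: (aT g gT); rewrite cnC; apply: cn_trans (cn_sub sub h2) _.
  by rewrite cnC; apply: cn_trans (cn_sub sub _) cg; rewrite cnC.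
- case/negP: (aT g gT); apply: cn_trans (cn_sub sub h2) _.
  by rewrite cnC; apply: cn_trans (cn_sub sub _) cg; rewrite cnC.
Qed.

Lemma cn_push p T S (c : V -> V) : (forall x, linked p T x (c x)) ->
  (forall e, e \in S -> linked p T (p e).1 (p e).2) ->
  forall x y, linked (pushp p c) S (c x) (c y) -> linked p T x y.
Proof.
move=> hc hS x y h; apply: cn_trans (hc x) _; rewrite cnC; apply: cn_trans (hc y) _; rewrite cnC.
apply: cn_le h => e /hS he /=.
by apply: cn_trans (hc _); apply: cn_trans he; rewrite cnC.
Qed.

(** Contracting an edge of the forest keeps the rest acyclic and loses a vertex. *)
Lemma card_acyc p T (X : {set V}) : acyc p T -> (forall e, e \in T -> ((p e).1 \in X) && ((p e).2 \in X)) ->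
  X != set0 -> #|T| < #|X|.
Proof.
have [n] := ubnP #|T|; elim: n p T X => // n IH p T X Tn aT wf X0.
have [->|[e eT]] := set_0Vmem T; first by rewrite cards0 card_gt0.
have /andP[aX bX] := wf e eT.
set a := (p e).1 in aX *; set b := (p e).2 in bX *.
have ab : a != b by apply/eqP => ab; have /acycP/(_ e eT)/negP := aT; apply; rewrite -/a -/b ab cn_refl.
set c := squash [set a; b] a.
have sq : #|c @: X| < #|X|.
  apply: card_squash; rewrite ?cards2 ?ab ?set21 //.
  by apply/subsetP => v; rewrite !inE => /orP[] /eqP ->.
rewrite (cardsD1 e) eT add1n; apply: leq_trans sq; rewrite ltnS.
apply: (IH (pushp p c)).
- by move: Tn; rewrite (cardsD1 e) eT add1n ltnS.
- apply/acycP => g; rewrite !inE => /andP[ge gT]; apply/negP => h.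
  have /acycP/(_ g gT)/negP := aT; apply; apply: (@cn_push p (T :\ g) (T :\ e :\ g) c) h.
    move=> x; rewrite /c /squash !inE; case: ifP => [|_]; last exact: cn_refl.
    case/orP => /eqP ->; first exact: cn_refl.
    by rewrite cnC; apply: (@cn_edge p (T :\ g) e); rewrite !inE eq_sym ge.
  by move=> f; rewrite !inE => /and3P[fg _ fT]; apply: cn_edge; rewrite !inE fg.
- by move=> g; rewrite !inE => /andP[_ /wf /andP[h1 h2]]; rewrite /= !imset_f.
- by apply/set0Pn; exists (c a); apply: imset_f.
Qed.

Lemma connect_ind (U : finType) (R : rel U) u0 (Q : U -> Prop) : Q u0 ->
  (forall u v, connect R u0 u -> R u v -> Q u -> Q v) -> forall u, connect R u0 u -> Q u.
Proof.
move=> Q0 Qs u /connectP[l]; elim/last_ind: l u => [|l v IH] u /=; first by move=> _ ->.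
rewrite rcons_path last_rcons => /andP[hl Rv] ->.
by apply: (Qs _ _ _ Rv); [apply/connectP; exists l|apply: IH].
Qed.

(* Take a pair of disjoint forests with a maximum number of edges.  The edges
   avoided by some pair reachable from it by exchanging single edges form a
   subgraph whose components are spanned by both forests. *)
Section Packing.
Variables (p : E -> V * V) (P : {set E}) (X : {set V}).
Hypothesis wf : forall e, e \in P -> ((p e).1 \in X) && ((p e).2 \in X).
Hypothesis X0 : X != set0.
Hypothesis dense : 2 * #|X| <= #|P| + 1.

Let pairs := ({set E} * {set E})%type.
Implicit Types (W : pairs) (i : bool).
Definition sel W i := if i then W.1 else W.2.
Definition upd W i T : pairs := if i then (T, W.2) else (W.1, T).
Definition forests W :=
  [&& W.1 \subset P, W.2 \subset P, [disjoint W.1 & W.2], acyc p W.1 & acyc p W.2].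
Definition size2 W := #|W.1| + #|W.2|.

Lemma forests0 : forests (set0, set0).
Proof.
have a0 : acyc p set0 by apply/acycP => e; rewrite inE.
by rewrite /forests /= sub0set a0 disjoints_subset sub0set.
Qed.

Definition W0 : pairs := [arg max_(W > (set0, set0) | forests W) size2 W].

Lemma W0P : forests W0 /\ forall W, forests W -> size2 W <= size2 W0.
Proof. by rewrite /W0; case: arg_maxnP => [|W fW mW]; [exact: forests0|split]. Qed.

Definition exch : rel pairs := fun W W' =>
  [exists i, exists e, exists f, [&& e \in P, e \notin W.1 :|: W.2, f \in sel W i, forests W' &
    W' == upd W i (e |: (sel W i :\ f))]].

Definition reach W := connect exch W0 W.
Definition avoidable := [set f in P | [exists W, reach W && (f \notin W.1 :|: W.2)]].

Lemma reachP W : reach W -> forests W /\ size2 W = size2 W0.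
Proof.
move: W; apply: connect_ind => [|W W' _]; first by have [] := W0P.
case/existsP => i /existsP[e /existsP[f /and5P[eP eW fW fW' /eqP W'E]]] [_ sz]; split=> //.
rewrite -sz W'E; move: eW fW; rewrite !inE negb_or /size2; case: i {W'E} => /=; case/andP=> e1 e2 fW.
  by rewrite cardsU1 !inE (negPf e1) andbF /= (cardsD1 f W.1) fW.
by rewrite cardsU1 !inE (negPf e2) andbF /= (cardsD1 f W.2) fW.
Qed.

Lemma sel_upd W i T : sel (upd W i T) i = T. Proof. by case: i. Qed.
Lemma sel_updN W i T : sel (upd W i T) (~~ i) = sel W (~~ i). Proof. by case: i. Qed.

Lemma forests_upd W i T : forests W -> T \subset P -> acyc p T -> [disjoint T & sel W (~~ i)] ->
  forests (upd W i T).
Proof.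
case/and5P => h1 h2 h3 h4 h5 TP aT d; apply/and5P; case: i d => /= d; split=> //.
by rewrite disjoint_sym.
Qed.

Lemma forests_sel W i : forests W -> [/\ sel W i \subset P, acyc p (sel W i) & [disjoint sel W i & sel W (~~ i)]].
Proof. by case/and5P => h1 h2 h3 h4 h5; case: i; split=> //=; rewrite disjoint_sym. Qed.

Lemma notin_sel W f i : f \notin W.1 :|: W.2 -> f \notin sel W i.
Proof. by rewrite !inE negb_or => /andP[h1 h2]; case: i. Qed.

(** If [f] joined two components of [sel W i], adding it would contradict maximality. So the forest
    has a path between its ends, and exchanging any edge of that path for [f] shows that edge to be
    avoidable. *)
Lemma cn_avoid W f i : reach W -> f \in P -> f \notin W.1 :|: W.2 ->
  linked p (sel W i :&: avoidable) (p f).1 (p f).2.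
Proof.
move=> rW fP fW; have [forW szW] := reachP rW; have [sP aW dW] := forests_sel i forW.
have fi := notin_sel i fW; have fni := notin_sel (~~ i) fW.
have [c|nc] := boolP (linked p (sel W i) (p f).1 (p f).2); last first.
  have : forests (upd W i (f |: sel W i)).
    apply: forests_upd => //; first by rewrite subUset sub1set fP.
      exact: acyc_add.
    by rewrite disjoints_subset subUset sub1set inE fni /= -disjoints_subset.
  move/(W0P.2); rewrite -szW /size2; case: (i) fi => fi /=; by rewrite cardsU1 fi add1n ?addSn ?addnS ltnn.
apply: cn_sub (cn_bridges aW c); apply/subsetP => g; rewrite !inE => /andP[gi ng].
rewrite gi (subsetP sP) //=; apply/existsP; exists (upd W i (f |: (sel W i :\ g))).
have dis : [disjoint f |: (sel W i :\ g) & sel W (~~ i)].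
  rewrite disjoints_subset subUset sub1set inE fni /= -disjoints_subset.
  by apply: disjointWl dW; apply: subD1set.
have fW' : forests (upd W i (f |: (sel W i :\ g))).
  apply: forests_upd => //.
    by rewrite subUset sub1set fP; apply: subset_trans (subD1set _ _) sP.
  apply: acyc_add => //; first by apply: acyc_sub aW; apply: subD1set.
  by rewrite !inE (negPf fi) andbF.
apply/andP; split.
  apply: connect_trans rW _; apply: connect1; apply/existsP; exists i; apply/existsP; exists f.
  by apply/existsP; exists g; apply/and5P.
have gn : g \notin sel W (~~ i) by move: dW; rewrite disjoints_subset => /subsetP/(_ _ gi); rewrite inE.
have gf : g != f by apply: contraNneq fi => <-.
by rewrite !inE; case: (i) gn => /= gn; rewrite !inE eqxx (negPf gf) (negPf gn).
Qed.

(** Undoing an exchange loses only the edge [e] that it added. The earlier pair avoids [e], so by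
    [cn_avoid] its own avoidable edges link the ends of [e]. *)
Lemma cn_reach W : reach W -> forall i x y, linked p (sel W i :&: avoidable) x y -> linked p (sel W0 i :&: avoidable) x y.
Proof.
move: W; apply: connect_ind => // W W' rW /existsP[j /existsP[e /existsP[f /and5P[eP eW fW fW' /eqP W'E]]]] IH i x y h.
apply: IH; apply: cn_le h => g; rewrite inE => /andP[gi ga].
have [gW|gW] := boolP (g \in sel W i); first by apply: cn_edge; rewrite inE gW.
have ge : g = e.
  move: gi gW; rewrite W'E; have [<-|ij] := eqVneq j i.
    by rewrite sel_upd !inE => /orP[/eqP //|/andP[_ ->]].
  have -> : i = ~~ j by case: (i) ij; case: (j).
  by rewrite sel_updN => ->.
by rewrite ge; apply: cn_avoid.
Qed.

Lemma cn_avoidable i x y : linked p avoidable x y -> linked p (sel W0 i :&: avoidable) x y.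
Proof.
apply: cn_le => f; rewrite inE => /andP[fP /existsP[W /andP[rW fW]]].
exact: cn_reach rW _ _ _ (cn_avoid _ rW fP fW).
Qed.

(** Two forests on [X] have at most [2 * (#|X| - 1)] edges, fewer than [P]. *)
Lemma avoidable_neq0 : exists e, e \in avoidable.
Proof.
have [fW _] := W0P; have [s1 a1 d] := forests_sel true fW; have [s2 a2 _] := forests_sel false fW.
have wf' T : T \subset P -> forall e, e \in T -> ((p e).1 \in X) && ((p e).2 \in X).
  by move=> TP e /(subsetP TP); apply: wf.
have c1 := card_acyc a1 (wf' _ s1) X0; have c2 := card_acyc a2 (wf' _ s2) X0.
have [Psub|] := boolP (P \subset W0.1 :|: W0.2).
  have := subset_leq_card Psub; rewrite cardsU; move: c1 c2 dense => /=; clear; lia.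
by case/subsetPn => e eP eW; exists e; rewrite inE eP; apply/existsP; exists W0; rewrite /reach connect0.
Qed.
End Packing.
End Connectivity.

(** * Two disjoint connected spanning edge sets *)

Section TreePacking.
Variables (V E : finType).
Implicit Types (p : E -> V * V) (T S F : {set E}) (x y a b v : V) (e f g : E).

Lemma degree_sum p (P : {set E}) (X : {set V}) :
  (forall e, e \in P -> ((p e).1 \in X) && ((p e).2 \in X)) ->
  \sum_(v in X) #|[set e in P | crossing p [set v] e]| = 2 * #|[set e in P | (p e).1 != (p e).2]|.
Proof.
move=> wf; under eq_bigr => v _ do rewrite -sum1dep_card big_mkcond /=.
rewrite exchange_big /= mulnC -sum_nat_const [RHS]big_mkcond /=; apply: eq_bigr => e _.
rewrite inE; case eP: (e \in P) => /=; last by rewrite big1.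
have /andP[h1 h2] := wf e eP; rewrite /crossing.
case: (eqVneq (p e).1 (p e).2) => [->|ne] /=; first by rewrite big1 // => v _; rewrite addbb.
rewrite (bigD1 (p e).1) //= (bigD1 (p e).2) ?h2 1?eq_sym //= !inE !eqxx (negPf ne) eq_sym (negPf ne) /=.
rewrite big1 // => v /andP[/andP[_ n1] n2]; rewrite !inE.
by rewrite eq_sym (negPf n1) eq_sym (negPf n2).
Qed.

(** The case of two trees in the theorem of Nash-Williams and Tutte. Both forests connect a
    component [U] of the avoidable edges by such edges. Contract [U], pack the rest by induction,
    and replace the avoidable edges used there by those of the respective forest. *)
Lemma tree_packing p (P : {set E}) (X : {set V}) :
  (forall e, e \in P -> ((p e).1 \in X) && ((p e).2 \in X)) ->
  (forall A : {set V}, A \subset X -> A != set0 -> A != X -> 4 <= #|[set e in P | crossing p A e]|) ->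
  exists S1 S2 : {set E}, [/\ S1 \subset P, S2 \subset P, [disjoint S1 & S2] &
    {in X &, forall x y, linked p S1 x y /\ linked p S2 x y}].
Proof.
have [n] := ubnP #|X|; elim: n p X => // n IH p X Xn wf cut.
have [X1|X1] := leqP #|X| 1.
  exists set0, set0; rewrite !sub0set disjoints_subset sub0set; split=> // x y xX yX.
  suff -> : x = y by split; apply: cn_refl.
  by apply/eqP; move/card_le1_eqP: X1 => /(_ x y xX yX) ->.
(* Without loops, the avoidable edge found below has two distinct ends in [U], so that contracting
   [U] makes progress. *)
set P' := [set e in P | (p e).1 != (p e).2].
have wf' e : e \in P' -> ((p e).1 \in X) && ((p e).2 \in X) by rewrite inE => /andP[/wf].
have X0 : X != set0 by rewrite -card_gt0; apply: ltnW.
have dense : 2 * #|X| <= #|P'| + 1.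
  have : 4 * #|X| <= 2 * #|P'|.
    rewrite -(degree_sum wf) mulnC -sum_nat_const; apply: leq_sum => v vX; apply: cut.
    - by rewrite sub1set.
    - by apply/set0Pn; exists v; rewrite inE.
    - by apply: contraTneq X1 => <-; rewrite cards1.
  by clear; lia.
have [e0 e0A] := avoidable_neq0 wf' X0 dense.
have := e0A; rewrite !inE -andbA => /and3P[e0P e0n _].
have /andP[aX bX] := wf e0 e0P; set a := (p e0).1 in aX e0n; set b := (p e0).2 in bX e0n.
set D := avoidable p P' in e0A; pose T i := sel (W0 p P') i :&: D.
have cT i x y : linked p D x y -> linked p (T i) x y by apply: cn_avoidable.
have DP : D \subset P by apply/subsetP => e; rewrite inE => /andP[]; rewrite inE => /andP[].
pose U := [set v in X | linked p D a v]; pose c := squash U a.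
have UX : U \subset X by apply/subsetP => v; rewrite inE => /andP[].
have aU : a \in U by rewrite inE aX cn_refl.
have bU : b \in U by rewrite inE bX; apply: cn_edge.
have U1 : 1 < #|U| by apply: (gt1 aU bU).
have [|||S1 [S2 [S1P S2P dS cS]]] := IH (pushp p c) (c @: X).
- by apply: leq_trans (card_squash aU UX U1) _.
- by move=> e /wf /andP[h1 h2]; rewrite /= !imset_f.
- move=> A AX A0 AnX; have -> : [set e in P | crossing (pushp p c) A e] = [set e in P | crossing p (pullset X c A) e].
    by apply/setP => e; rewrite !inE; case eP: (e \in P) => //=; rewrite (crs_push c wf).
  apply: cut.
  + by apply/subsetP => v; rewrite inE => /andP[].
  + have /set0Pn[v vA] := A0; have /imsetP[u uX vu] := subsetP AX _ vA.
    by apply/set0Pn; exists u; rewrite inE uX -vu.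
  + apply: contra AnX => /eqP pX; rewrite eqEsubset AX; apply/subsetP => v /imsetP[u uX ->].
    by move: uX; rewrite -pX inE => /andP[].
have cc i x : x \in X -> linked p (T i) x (c x).
  move=> xX; rewrite /c /squash; case: ifP => [|_]; last exact: cn_refl.
  by rewrite inE => /andP[_ h]; rewrite cnC; apply: cT.
have key i S x y : S \subset P -> x \in X -> y \in X -> linked (pushp p c) S (c x) (c y) ->
    linked p ((S :\: D) :|: T i) x y.
  move=> SP xX yX h; have sub : T i \subset (S :\: D) :|: T i by apply: subsetUr.
  apply: cn_trans (cn_sub sub (cc i x xX)) _; rewrite cnC.
  apply: cn_trans (cn_sub sub (cc i y yX)) _; rewrite cnC.
  apply: cn_le h => e eS /=; have /andP[h1 h2] := wf e (subsetP SP _ eS).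
  apply: cn_trans (cn_sub sub (cc i _ h2)).
  apply: (@cn_trans _ _ _ _ (p e).1); first by rewrite cnC; apply: (cn_sub sub (cc i _ h1)).
  have [eD|eD] := boolP (e \in D); last by apply: cn_edge; rewrite in_setU in_setD eD eS.
  by apply: (cn_sub sub); apply: cT; apply: cn_edge.
exists ((S1 :\: D) :|: T true), ((S2 :\: D) :|: T false); split.
- by rewrite subUset (subset_trans (subsetDl _ _) S1P) (subset_trans (subsetIr _ _) DP).
- by rewrite subUset (subset_trans (subsetDl _ _) S2P) (subset_trans (subsetIr _ _) DP).
- have [[fW _] dd] := (W0P p P', dS); have [_ _ d12] := forests_sel true fW.
  move/pred0P: dd => dd; move/pred0P: d12 => d12; apply/pred0P => e.
  have := d12 e; have := dd e; rewrite /= !in_setU !in_setD /T !in_setI /=.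
  by case: (e \in D); rewrite ?andbF ?andbT ?orbF.
move=> x y xX yX; have [h1 h2] := cS _ _ (imset_f c xX) (imset_f c yX).
by split; apply: key.
Qed.
End TreePacking.

(** * Degree parity and Euler tours *)
Section Parity.
Variables (V E : finType).
Implicit Types (p : E -> V * V) (T S F J : {set E}) (x y a b v u w : V) (e f g : E).

Definition odd_degree p F v : bool := \big[addb/false]_(e in F) (((p e).1 == v) (+) ((p e).2 == v)).

Lemma par_D1 p F e v : e \in F -> odd_degree p F v = ((p e).1 == v) (+) ((p e).2 == v) (+) odd_degree p (F :\ e) v.
Proof. by move=> eF; rewrite /odd_degree (big_setD1 e). Qed.

Definition symd J J' : {set E} := (J :\: J') :|: (J' :\: J).

Lemma par_symd p J J' v : odd_degree p (symd J J') v = odd_degree p J v (+) odd_degree p J' v.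
Proof.
rewrite /odd_degree !(big_mkcond (fun e => e \in _)) -big_split /=; apply: eq_bigr => e _.
by rewrite !inE; case: (e \in J); case: (e \in J') => /=; rewrite ?addbF ?addbb.
Qed.

Lemma par_path p S x y : linked p S x y -> exists2 J : {set E}, J \subset S & forall v, odd_degree p J v = (v == x) (+) (v == y).
Proof.
move: y; apply: connect_ind => [|y z _ /adjP[e eS pe] [J JS hJ]].
  by exists set0; [exact: sub0set|move=> v; rewrite /odd_degree big_set0 addbb].
exists (symd J [set e]).
  by rewrite subUset !(subset_trans (subsetDl _ _)) // sub1set.
move=> v; rewrite par_symd hJ /odd_degree big_set1 ![_ == v]eq_sym.
by case: pe => -> /=; case: (v == x); case: (v == y); case: (v == z).
Qed.

(** Take the symmetric difference of paths from the vertices satisfying [g] to a fixed [a]. Their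
    contributions at the end [a] cancel because the number of paths is even. *)
Lemma join_exists p S (g : pred V) : (forall x y, linked p S x y) ->
  \big[addb/false]_v g v = false -> exists2 J : {set E}, J \subset S & forall v, odd_degree p J v = g v.
Proof.
move=> cS gev.
have [/eqP V0|/card_gt0P[a _]] := posnP #|V|.
  by exists set0; [exact: sub0set|move=> v; have := card0_eq (eqP V0) v; rewrite inE].
suff [J JS hJ] : exists2 J : {set E}, J \subset S & forall v, odd_degree p J v =
    \big[addb/false]_(x <- index_enum V | g x) ((v == x) (+) (v == a)).
  exists J => // v; rewrite hJ big_split /=.
  have -> : \big[addb/false]_(x | g x) (v == x) = g v.
    rewrite big_mkcond (bigD1 v) //= eqxx big1 ?addbF; first by case: (g v).
    by move=> x /negPf xv; rewrite eq_sym xv; case: (g x).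
  have -> : \big[addb/false]_(x | g x) (v == a) = (v == a) && (\big[addb/false]_x g x).
    rewrite big_mkcond /=; case: (v == a) => /=; last by rewrite big1 // => x _; case: (g x).
    by apply: eq_bigr => x _; case: (g x).
  by rewrite gev andbF addbF.
elim: (index_enum V) => [|x s [J JS hJ]].
  by exists set0; [exact: sub0set|move=> v; rewrite /odd_degree big_set0 big_nil].
have [gx|gx] := boolP (g x); last by exists J => // v; rewrite big_cons (negPf gx).
have [J1 J1S hJ1] := par_path (cS x a).
exists (symd J1 J); first by rewrite subUset !(subset_trans (subsetDl _ _)).
by move=> v; rewrite par_symd hJ1 hJ big_cons gx.
Qed.

Lemma par_sum p F (U : {set V}) :
  \big[addb/false]_(v in U) odd_degree p F v = \big[addb/false]_(e in F) crossing p U e.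
Proof.
rewrite exchange_big /=; apply: eq_bigr => e _; rewrite big_split /= /crossing.
have pt x : \big[addb/false]_(v in U) (x == v) = (x \in U).
  rewrite big_mkcond (bigD1 x) //= eqxx big1 ?addbF; first by case: (x \in U).
  by move=> v /negPf vx; rewrite eq_sym vx; case: ifP.
by rewrite !pt.
Qed.
End Parity.

(** * Signed Euler trails *)

Section Euler.
Local Open Scope ring_scope.
Variables (V E : finType) (p : E -> V * V) (neg : E -> bool).
Implicit Types (F : {set E}) (a b u v w : V) (e f g : E) (h : E -> bool).

Definition sgn (c : bool) : int := if c then 1 else -1.

(** The bit at the first end of [e] is [h e]. The bit at the second end, [neg e == h e], is the one
    that the sign forces: equal for a negative edge, opposite for a positive one. *)
Definition excess F h v : int :=
  \sumz_(e in F) (sgn (h e) * ((p e).1 == v)%:Z + sgn (neg e == h e) * ((p e).2 == v)%:Z).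

Lemma sgnN c : sgn (~~ c) = - sgn c. Proof. by case: c. Qed.

Lemma eul_flip F h v : excess F (fun e => ~~ h e) v = - excess F h v.
Proof.
rewrite -isumN; apply: eq_isum => e _.
have -> : (neg e == ~~ h e) = ~~ (neg e == h e) by case: (neg e); case: (h e).
by rewrite !sgnN !mulNr opprD.
Qed.

Definition joins e a u := p e = (a, u) \/ p e = (u, a).

Lemma joins_cn e a u F : joins e a u -> e \in F -> linked p F a u.
Proof. by move=> [] pe eF; have := cn_edge p eF; rewrite pe // cnC. Qed.

Lemma par_joins F e a u v : joins e a u -> e \in F -> odd_degree p (F :\ e) v = odd_degree p F v (+) (v == a) (+) (v == u).
Proof.
move=> je eF; rewrite (par_D1 _ _ eF) ![v == _]eq_sym.
by case: je => -> /=; case: (a == v); case: (u == v); case: (odd_degree _ _ _).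
Qed.

Lemma first_edge F a v : linked p F a v -> a != v -> exists e u, e \in F /\ joins e a u.
Proof.
case/connectP => -[|u l] /=; first by move=> _ ->; rewrite eqxx.
by case/andP => /adjP[e eF pe] _ _ _; exists e, u.
Qed.

(** The component [U] of [u] left by deleting [e] avoids [a]. Its degrees sum to an even number, so
    the change of parity at [u] must be matched by [b] lying in [U]. *)
Lemma parity_cut F b e a u : (forall v, odd_degree p F v = (v == a) (+) (v == b)) -> e \in F -> joins e a u ->
  ~~ linked p (F :\ e) a u -> linked p (F :\ e) u b.
Proof.
move=> hp eF je nc; set U := [set v | linked p (F :\ e) u v].
have ua : a \notin U by rewrite inE cnC.
have uU : u \in U by rewrite inE cn_refl.
have : \big[addb/false]_(v in U) odd_degree p (F :\ e) v = false.
  rewrite par_sum big1 // => g gF; rewrite /crossing !inE.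
  have eg := cn_edge p gF; suff -> : linked p (F :\ e) u (p g).1 = linked p (F :\ e) u (p g).2 by rewrite addbb.
  by apply/idP/idP => h; apply: cn_trans h _ => //; rewrite cnC.
rewrite (eq_bigr (fun v => (v == b) (+) (v == u))); last first.
  move=> v vU; rewrite (par_joins _ je eF) hp.
  by case: (v == a); case: (v == b); case: (v == u).
have pt x : \big[addb/false]_(v in U) (v == x) = (x \in U).
  rewrite big_mkcond (bigD1 x) //= eqxx big1 ?addbF; first by case: (x \in U).
  by move=> v /negPf ->; case: ifP.
by rewrite big_split /= !pt uU addbT => /negbFE; rewrite inE.
Qed.

(* Fleury's algorithm: if two edges at [a] are bridges whose removal separates
   [a] from their other ends, parity forces both far sides to contain [b]. *)
Lemma good_edge F a b : F != set0 -> (forall e, e \in F -> linked p F a (p e).1) ->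
  (forall v, odd_degree p F v = (v == a) (+) (v == b)) ->
  exists e u, [/\ e \in F, joins e a u & forall g, g \in F :\ e -> linked p (F :\ e) u (p g).1].
Proof.
move=> F0 hc hp.
have nonbridge e u : e \in F -> joins e a u -> linked p (F :\ e) a u ->
    forall g, g \in F :\ e -> linked p (F :\ e) u (p g).1.
  move=> eF je c g; rewrite in_setD1 => /andP[ge gF].
  rewrite cnC in c; apply: (cn_trans c).
  apply: cn_le (hc g gF) => f fF; have [->|fe] := eqVneq f e; last by apply: cn_edge; rewrite in_setD1 fe.
  by rewrite cnC in c; case: je => ->; rewrite //= cnC.
have [e [u [eF je]]] : exists e u, e \in F /\ joins e a u.
  have /set0Pn[g gF] := F0; have [ag|ag] := eqVneq a (p g).1; last exact: first_edge (hc g gF) ag.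
  by exists g, (p g).2; split=> //; left; rewrite ag; case: (p g).
have [c|nc] := boolP (linked p (F :\ e) a u); first by exists e, u; split=> //; apply: nonbridge.
have addE : e |: F :\ e = F by rewrite setD1K.
have [[f [w [fF fe jf]]]|no] := classic (exists f w, [/\ f \in F, f != e & joins f a w]); last first.
  (* Here [e] is the only edge at [a], so every other edge was reached through [u] and still is. *)
  exists e, u; split=> // g; rewrite in_setD1 => /andP[ge gF].
  have iso v : linked p (F :\ e) a v -> a = v.
    move=> h; apply/eqP/negPn/negP => av; have [f [w [fF jf]]] := first_edge h av.
    by move: fF; rewrite in_setD1 => /andP[fe fF]; apply: no; exists f, w.
  have := hc g gF; rewrite -{1}addE => /cn_add[/iso ag|[h1 h2]|[h1 h2]].
  - by case: no; exists g, (p g).2; split=> //; left; rewrite ag; case: (p g).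
  - case: je h1 h2 => -> //= h1 _; by rewrite h1 in nc.
  - case: je h1 h2 => -> //= h1 _; by rewrite h1 in nc.
have [c|nc2] := boolP (linked p (F :\ f) a w); first by exists f, w; split=> //; apply: nonbridge.
have cu := parity_cut hp eF je nc; have cw := parity_cut hp fF jf nc2.
case/negP: nc.
have feF : f \in F :\ e by rewrite in_setD1 fe.
have efF : e \in F :\ f by rewrite in_setD1 eq_sym fe.
have sub : F :\ e :\ f \subset F :\ e by apply: subD1set.
have sub2 : F :\ f :\ e \subset F :\ f by apply: subD1set.
have swap : F :\ f :\ e = F :\ e :\ f by rewrite !setDDl setUC.
have aw : linked p (F :\ e) a w := joins_cn jf feF.
have au : linked p (F :\ f) a u := joins_cn je efF.
have h1 : linked p (F :\ e) a u \/ linked p (F :\ e :\ f) u b.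
  have := cu; rewrite -{1}(setD1K feF) => /cn_add[h|[h _]|[h _]]; first by right.
    left; rewrite cnC; apply: cn_trans (cn_sub sub h) _; case: jf => -> /=; rewrite ?cn_refl //.
    by rewrite cnC.
  left; rewrite cnC; apply: cn_trans (cn_sub sub h) _; case: jf => -> /=; rewrite ?cn_refl //.
  by rewrite cnC.
case: h1 => // ub.
have h2 : linked p (F :\ f) a w \/ linked p (F :\ e :\ f) w b.
  have := cw; rewrite -{1}(setD1K efF) => /cn_add[h|[h _]|[h _]]; first by right; rewrite -swap.
    left; rewrite cnC; apply: cn_trans (cn_sub sub2 h) _; case: je => -> /=; rewrite ?cn_refl //.
    by rewrite cnC.
  left; rewrite cnC; apply: cn_trans (cn_sub sub2 h) _; case: je => -> /=; rewrite ?cn_refl //.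
  by rewrite cnC.
case: h2 => [h2|wb]; first by rewrite h2 in nc2.
apply: cn_trans aw _; apply: cn_trans (cn_sub sub wb) _; rewrite cnC; exact: cn_sub sub ub.
Qed.

(** The bits cancel at each passage of the trail through a vertex. The first edge gets a positive
    bit at [a], and if it is negative the labels of the remaining trail are inverted; hence the sign
    at [b] records the parity of the number of negative edges. *)
Lemma fleury F a b : (forall e, e \in F -> linked p F a (p e).1) ->
  (forall v, odd_degree p F v = (v == a) (+) (v == b)) ->
  exists h, forall v, excess F h v = (a == v)%:Z + sgn (odd #|[set e in F | neg e]|) * (b == v)%:Z.
Proof.
have [n] := ubnP #|F|; elim: n F a => // n IH F a Fn hc hp.
have [F0|F0] := eqVneq F set0.
  exists xpred0 => v; rewrite /excess F0 isum_set0.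
  have -> : [set e in set0 | neg e] = set0 by apply/setP => e; rewrite !inE.
  have := hp a; rewrite F0 /odd_degree big_set0 eqxx /= => /esym/negbFE/eqP ->.
  by rewrite cards0 /sgn /= mulN1r subrr.
have [e [u [eF je hc']]] := good_edge F0 hc hp.
have [||h hh] := IH (F :\ e) u _ hc'.
- by move: Fn; rewrite (cardsD1 e F) eF add1n ltnS.
- move=> v; rewrite (par_joins _ je eF) hp.
  by case: (v == a); case: (v == b); case: (v == u).
have cE : #|[set g in F | neg g]| = (neg e + #|[set g in F :\ e | neg g]|)%N.
  rewrite (cardsD1 e) inE eF /=; congr (_ + _)%N; apply: eq_card => g; rewrite !inE.
  by case: (g == e).
pose h' g := if g == e then (if neg e then true else (p e).1 == a) else (if neg e then ~~ h g else h g).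
exists h' => v; rewrite /excess (isum_setD1 _ eF) cE oddD oddb.
have -> : \sumz_(g in F :\ e) (sgn (h' g) * ((p g).1 == v)%:Z + sgn (neg g == h' g) * ((p g).2 == v)%:Z)
   = if neg e then - excess (F :\ e) h v else excess (F :\ e) h v.
  case ne : (neg e); first rewrite -eul_flip; apply: eq_isum => g; rewrite in_setD1 /h' ne => /andP[/negPf -> _] //.
rewrite hh /h' eqxx.
move: (odd _) => q; case ne: (neg e); rewrite /= ?sgnN.
  by case: je => -> /=; rewrite /sgn; clear; case: q; lia.
case: je => -> /=; rewrite ?eqxx /=; first by rewrite /sgn; clear; case: q; lia.
case: (eqVneq u a) => [->|_]; rewrite /sgn; clear; case: q; lia.
Qed.
End Euler.

(** * From modular flows to integer flows *)
Section Rounding.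
Local Open Scope ring_scope.
Variables (V E : finType) (p : E -> V * V) (P : {set E}) (k : int) (beta : V -> int).
Hypothesis k1 : 1 <= k.
Implicit Types (psi : E -> int) (u v w x y : V) (A U : {set V}) (e : E).

(** The sign of [psi e] is the direction of flow relative to [p e]. Values [k] and [-(k + 1)], or
    [k + 1] and [-k], differ by the modulus [2 * k + 1], so an edge can be reversed without changing
    residues. *)
Definition two_valued psi := forall e, (k <= psi e <= k + 1) \/ (k <= - psi e <= k + 1).

Definition net psi v : int :=
  \sumz_(e in P) (psi e * (((p e).1 == v)%:Z - ((p e).2 == v)%:Z)) + beta v.

Definition arc psi : rel V := fun x y =>
  [exists e in P, ((0 < psi e) && (p e == (x, y))) || ((psi e < 0) && (p e == (y, x)))].

(** Each edge of the path is reversed, and the changes cancel at inner vertices. The clause on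
    changed edges ensures that the first edge still has its old value once the rest of the path,
    which avoids [x], has been treated. *)
Lemma push_path psi l x : two_valued psi -> path (arc psi) x l -> uniq (x :: l) ->
  exists psi', [/\ two_valued psi',
    forall e, psi' e != psi e -> ((p e).1 \in x :: l) && ((p e).2 \in x :: l) &
    forall v, net psi' v = net psi v - (2 * k + 1) * (x == v)%:Z + (2 * k + 1) * (last x l == v)%:Z].
Proof.
move=> tv; elim: l x => [|y l IH] x.
  by exists psi; split=> // [e|v]; [rewrite eqxx|rewrite subrK].
rewrite [path _ _ _]/= => /andP[/exists_inP[e eP he] hl].
rewrite [uniq _]/= -/(uniq (y :: l)) => /andP[xl ul].
have {IH} [psi1 [tv1 ch1 net1]] := IH y hl ul.
have pe : (0 < psi e /\ p e = (x, y)) \/ (psi e < 0 /\ p e = (y, x)).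
  by case/orP: he => /andP[h /eqP ->]; [left|right].
have psi1e : psi1 e = psi e.
  apply/eqP/negPn/negP => /ch1; case: pe => -[_ ->] /=; by rewrite (negPf xl) ?andbF.
have xy : x == y = false by apply/eqP => xy; rewrite xy mem_head in xl.
exists (fun g => if g == e then (if 0 < psi e then psi e - (2 * k + 1) else psi e + (2 * k + 1)) else psi1 g); split.
- move=> g; case: (eqVneq g e) => // _; have := tv e; case: ltrP => h; move: h k1; clear; lia.
- move=> g; case: (eqVneq g e) => [-> _|_ /ch1 /andP[h1 h2]]; last by rewrite !(in_cons x) h1 h2 !orbT.
  by case: pe => -[_ ->] /=; rewrite !in_cons !eqxx ?orbT.
move=> v; have := net1 v; rewrite /net !(isum_setD1 _ eP) eqxx psi1e.
have -> : \sumz_(g in P :\ e) ((if g == e then (if 0 < psi e then psi e - (2 * k + 1) else psi e + (2 * k + 1)) else psi1 g)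
    * (((p g).1 == v)%:Z - ((p g).2 == v)%:Z)) =
  \sumz_(g in P :\ e) (psi1 g * (((p g).1 == v)%:Z - ((p g).2 == v)%:Z)).
  by apply: eq_isum => g; rewrite in_setD1 => /andP[/negPf -> _].
rewrite [last _ _]/=; case: pe => -[hs ->]; rewrite /= ?hs ?(lt_gtF hs); clear; by case: (x == v); case: (y == v); case: (last y l == v) => /=; lia.
Qed.

Lemma sum_net psi A : isum A (net psi) =
  \sumz_(e in P) (psi e * (((p e).1 \in A)%:Z - ((p e).2 \in A)%:Z)) + isum A beta.
Proof.
rewrite isumD isum_exchange; congr (_ + _); apply: eq_isum => e _.
by rewrite isumZ isumB !isum_pt.
Qed.

(* The values of [net] and the bound are integers in a fixed class modulo
   [2 k + 1], hence the additional [2 k]. *)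
Lemma rounding psi : two_valued psi -> (forall v, exists j, net psi v = j * (2 * k + 1)) ->
  isum setT beta = 0 ->
  (forall A, isum A beta <= k * (\sumz_(e in P) (crossing p A e)%:Z) + 2 * k) ->
  exists2 psi', two_valued psi' & forall v, net psi' v = 0.
Proof.
move=> tv hM b0 hcut; have [n] := ubnP (absz (\sumz_(v in setT) `|net psi v|)).
elim: n psi tv hM => // n IH psi tv hM Sn.
have sum0 : isum setT (net psi) = 0.
  by rewrite sum_net b0 isum0 // => e _; rewrite !inE subrr mulr0.
have [[v0 v0p]|np] := classic (exists v, 0 < net psi v); last first.
  exists psi => // v; apply/eqP; rewrite eq_le; apply/andP; split.
    by rewrite leNgt; apply/negP => h; apply: np; exists v.
  have : isum (setT :\ v) (net psi) <= isum (setT :\ v) (fun=> 0).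
    by apply: isum_le => u _; rewrite leNgt; apply/negP => h; apply: np; exists u.
  rewrite (isum0 (f := fun=> 0)) //; have := isum_setD1 (net psi) (in_setT v); rewrite sum0.
  by move: (isum _ _) (net _ _) => a c; clear; lia.
have big v : 0 < net psi v -> 2 * k + 1 <= net psi v.
  have [j ->] := hM v; case: (lerP j 0) => hj; move: hj k1; clear; nia.
have small v : net psi v < 0 -> net psi v <= - (2 * k + 1).
  have [j ->] := hM v; case: (lerP 0 j) => hj; move: hj k1; clear; nia.
pose U := [set u | connect (arc psi) v0 u].
have [[w [wU wn]]|nn] := classic (exists w, w \in U /\ net psi w < 0).
  move: wU; rewrite inE => /connectP[l hl hw].
  case/shortenP: hl hw => l' hl' ul' _ hw.
  have [psi' [tv' _ net']] := push_path tv hl' ul'; rewrite -hw in net'.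
  apply: (IH psi' tv') => [v|].
    have [j hj] := hM v; exists (j - (v0 == v)%:Z + (w == v)%:Z); rewrite net' hj.
    by clear; lia.
  have vw : v0 == w = false by apply/eqP => h; move: v0p wn; rewrite h; clear; lia.
  have : \sumz_(v in setT) `|net psi' v| = \sumz_(v in setT) `|net psi v| - 2 * (2 * k + 1).
    have -> : 2 * (2 * k + 1) = \sumz_(v in setT) ((2 * k + 1) * ((v0 == v)%:Z + (w == v)%:Z)).
      by rewrite isumZ isumD !isum_pt !inE; clear; lia.
    rewrite -isumB; apply: eq_isum => v _; rewrite net'.
    have := big v0 v0p; have := small w wn.
    case: (eqVneq v0 v) => [<-|_]; first by rewrite eq_sym vw; move: k1; clear; lia.
    by case: (eqVneq w v) => [<-|_]; move: k1; clear; lia.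
  have := isum_ge0 setT (fun v => normr_ge0 (net psi' v)).
  move: Sn k1; move: (isum _ _) (\sumz_(v in setT) `|net psi' v|); clear; lia.
(* No arc leaves [U], so every crossing edge carries at least [k] into it, and the bound on [beta]
   leaves a net sum of at most [2 * k]. *)
exfalso; have : 2 * k + 1 <= isum U (net psi).
  have v0U : v0 \in U by rewrite inE connect0.
  rewrite (isum_setD1 _ v0U); have := big v0 v0p.
  have : isum (U :\ v0) (fun=> 0) <= isum (U :\ v0) (net psi).
    apply: isum_le => u; rewrite in_setD1 => /andP[_ uU]; rewrite leNgt; apply/negP => h.
    by apply: nn; exists u.
  rewrite (isum0 (f := fun=> 0)) //; move: (isum _ _) (net _ _) => a c; clear; lia.
have : \sumz_(e in P) (psi e * (((p e).1 \in U)%:Z - ((p e).2 \in U)%:Z)) <= \sumz_(e in P) (- k * (crossing p U e)%:Z).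
  apply: isum_le => e eP; rewrite /crossing.
  have out x y : arc psi x y -> x \in U -> y \in U.
    by move=> a; rewrite !inE => /connect_trans; apply; apply: connect1.
  have h1 : 0 < psi e -> (p e).1 \in U -> (p e).2 \in U.
    move=> h; apply: out; apply/exists_inP; exists e => //; rewrite h; by case: (p e) => a c /=; rewrite eqxx.
  have h2 : psi e < 0 -> (p e).2 \in U -> (p e).1 \in U.
    move=> h; apply: out; apply/exists_inP; exists e => //; rewrite h; by case: (p e) => a c /=; rewrite eqxx orbT.
  move: h1 h2 (tv e) k1; clear.
  by case: (_ \in U); case: (_ \in U) => /=; lia.
rewrite sum_net isumZ; have := hcut U; move: (\sumz_(e in P) (crossing p U e)%:Z) => c; rewrite mulNr; clear; lia.
Qed.
End Rounding.

(** * Flows on signed graphs *)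
Section SignedFlows.
Local Open Scope ring_scope.
Variables (V E : finType) (p : E -> V * V).
Implicit Types (A S : {set V}) (P : {set E}) (v a : V) (e : E).

(** Without tokens, a cut of size at least [3 * (M - 1)] is admissible for every demand: the
    interval contains [M] consecutive integers. *)
Lemma orientation_mod (M : int) P (s : V -> int) : 2 <= M ->
  (exists j, isum setT s = #|P|%:Z + j * M) ->
  (forall A, A != set0 -> A != setT -> 3 * (M - 1) <= \sumz_(e in P) (crossing p A e)%:Z) ->
  exists o, forall v, exists j, \sumz_(e in P) (tail p o e == v)%:Z = s v + j * M.
Proof.
move=> M2 [i hi] cut.
have I : token_instance M setT P p s (fun=> 0) (fun=> 0) set0.
  split=> //.
  - by move=> e _; rewrite !inE.
  - by rewrite isum0 // /token_bound; left; move: M2; clear; lia.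
  - exists i; rewrite /cut_demand hi.
    have -> : \sumz_(e in P) (inside p setT e)%:Z = #|P|%:Z.
      by rewrite -(isum_card (subxx P)); apply: eq_isum => e ->; rewrite /inside !inE.
    by rewrite isum0 //; clear; lia.
  move=> A _ AnT; rewrite subset0 => A0; have := cut A A0 AnT.
  rewrite /cut_size ![isum A _]isum0 //; set w := cut_demand _ _ _ _; set d := isum P _ => tip.
  exists ((w - (M - 1)) %/ M)%Z.
  have := divz_eq (w - (M - 1)) M; have Mn0 : M != 0 by apply/eqP => M0; move: M2; rewrite M0.
  have := modz_ge0 (w - (M - 1)) Mn0; have := ltz_pmod (w - (M - 1)) (_ : 0 < M).
  move: (_ %/ _)%Z (_ %% _)%Z => q r' /(_ _) h; move: h tip M2; clear; lia.
have [o so] := modular_orientation M2 I; exists o => v.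
by have [j hj] := so v (in_setT v); exists j; rewrite -hj addr0.
Qed.

Lemma half_valE c x : half_val c x = sgn c * x.
Proof. by case: c; rewrite /half_val /sgn ?mul1r ?mulN1r. Qed.

Lemma conservationE (tau : E -> bool * bool) (f : E -> int) v :
  \sum_(e | (p e).1 == v) half_val (tau e).1 (f e) + \sum_(e | (p e).2 == v) half_val (tau e).2 (f e) =
  \sumz_(e in [set: E]) ((sgn (tau e).1 * ((p e).1 == v)%:Z + sgn (tau e).2 * ((p e).2 == v)%:Z) * f e).
Proof.
have toI (Q : pred E) (F : E -> int) : \sum_(e | Q e) F e = \sumz_(e in [set: E]) (if Q e then F e else 0).
  by rewrite /isum big_mkcond /=; apply: eq_bigl => e; rewrite inE.
rewrite !toI -isumD; apply: eq_isum => e _.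
rewrite !half_valE; case: eqP => _; case: eqP => _; clear; lia.
Qed.

Lemma isum_setC (P : {set E}) (f : E -> int) : isum setT f = isum P f + isum (~: P) f.
Proof. by rewrite /isum (bigID (mem P)) /=; congr (_ + _); apply: eq_bigl => e; rewrite !inE. Qed.

Lemma sgn_odd_add1 (c : bool) : 1 + sgn c = 2 * c%:Z. Proof. by case: c. Qed.

Section PositiveCuts.
Variables (k : nat) (sigma : signature E).
Hypothesis k0 : (0 < k)%N.
Let Ng := negative_edges sigma.
Let P := ~: Ng.
Hypothesis pos_cut : forall A, A != set0 -> A != setT -> 6 * k%:Z <= \sumz_(e in P) (crossing p A e)%:Z.
Hypothesis neg_card : ~~ odd #|Ng| \/ (2 * k + 1 <= #|Ng|)%N.

(* [h] marks the sink edges. *)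
Lemma neg_labels a : exists h : E -> bool,
  (forall A, \sumz_(e in Ng) (sgn (h e) * (((p e).1 \in A)%:Z + ((p e).2 \in A)%:Z)) <=
     2 * (odd #|Ng|)%:Z + \sumz_(e in P) (crossing p A e)%:Z) /\
  \sumz_(e in Ng) sgn (h e) = (odd #|Ng|)%:Z.
Proof.
have cnt A : (#|[set e in P | crossing p A e]|)%:Z = \sumz_(e in P) (crossing p A e)%:Z.
  have sub : [set e in P | crossing p A e] \subset P by apply/subsetP => e; rewrite inE => /andP[].
  by rewrite -(isum_card sub); apply: eq_isum => e eP; rewrite inE eP.
have [||S1 [S2 [S1P S2P dS cS]]] := @tree_packing _ _ p P setT.
- by move=> e _; rewrite !inE.
- by move=> A _ A0 AT; have := pos_cut A0 AT; rewrite -cnt; move: k0; clear; lia.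
have [||J JS1 hJ] := @join_exists _ _ p S1 (odd_degree p setT).
- by move=> x y; have [] := cS x y (in_setT x) (in_setT y).
- have <- : \big[addb/false]_(v in setT) odd_degree p setT v = \big[addb/false]_v odd_degree p setT v.
    by apply: eq_bigl => v; rewrite inE.
  by rewrite par_sum big1 // => e _; rewrite /crossing !inE.
have CJ : ~: J = symd setT J by apply/setP => e; rewrite !inE ?andbF ?orbF ?andbT.
have [||h hh] := @fleury _ _ p sigma (~: J) a a.
- move=> e _; apply: (@cn_sub _ _ _ _ S2); last by have [] := cS a (p e).1 (in_setT _) (in_setT _).
  apply/subsetP => g gS2; rewrite inE; apply/negP => /(subsetP JS1) gS1.
  by move: (disjointFr dS gS1); rewrite gS2.
- by move=> v; rewrite CJ par_symd hJ !addbb.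
have NJ : [set e in ~: J | sigma e] = Ng.
  apply/setP => e; rewrite !inE; case eN: (sigma e); rewrite ?andbF ?andbT //.
  by apply/negP => /(subsetP JS1)/(subsetP S1P); rewrite !inE eN.
have NgJ : Ng \subset ~: J by rewrite -NJ; apply/subsetP => e; rewrite inE => /andP[].
(* The tour has excess 2 at [a] if [#|Ng|] is odd, and none elsewhere. Once the positive edges are
   moved to the right, only those crossing [A] contribute, each at most one unit. *)
have key A : \sumz_(e in Ng) (sgn (h e) * (((p e).1 \in A)%:Z + ((p e).2 \in A)%:Z)) =
   2 * (odd #|Ng|)%:Z * (a \in A)%:Z
   - \sumz_(e in P) (if e \in J then 0 else sgn (h e) * (((p e).1 \in A)%:Z - ((p e).2 \in A)%:Z)).
  have : isum A (excess p sigma (~: J) h) = 2 * (odd #|Ng|)%:Z * (a \in A)%:Z.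
    rewrite -isum_pt -isumZ; apply: eq_isum => v _; rewrite hh NJ -sgn_odd_add1.
    by rewrite mulrDl mul1r.
  rewrite /excess isum_exchange => <-.
  have -> : \sumz_(e in ~: J) \sumz_(v in A) (sgn (h e) * ((p e).1 == v)%:Z + sgn (sigma e == h e) * ((p e).2 == v)%:Z)
    = \sumz_(e in setT) (if e \in J then 0 else
         sgn (h e) * ((p e).1 \in A)%:Z + sgn (sigma e == h e) * ((p e).2 \in A)%:Z).
    rewrite -[~: J](setTI) (_ : setT :&: ~: J = [set e in setT | e \notin J]); last by apply/setP => e; rewrite !inE.
    rewrite isum_filter; apply: eq_isum => e _; case: (e \in J) => //=.
    by rewrite isumD !isumZ !isum_pt.
  rewrite (isum_setC Ng).
  have -> : \sumz_(e in Ng) (if e \in J then 0 else sgn (h e) * ((p e).1 \in A)%:Z + sgn (sigma e == h e) * ((p e).2 \in A)%:Z)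
    = \sumz_(e in Ng) (sgn (h e) * (((p e).1 \in A)%:Z + ((p e).2 \in A)%:Z)).
    apply: eq_isum => e eN; have := subsetP NgJ _ eN; rewrite inE => /negPf ->.
    by move: eN; rewrite inE => ->; rewrite mulrDr; case: (h e).
  suff -> : \sumz_(e in ~: Ng) (if e \in J then 0 else sgn (h e) * ((p e).1 \in A)%:Z + sgn (sigma e == h e) * ((p e).2 \in A)%:Z)
    = \sumz_(e in P) (if e \in J then 0 else sgn (h e) * (((p e).1 \in A)%:Z - ((p e).2 \in A)%:Z)).
    by rewrite addrK.
  apply: eq_isum => e; rewrite !inE => /negPf ->; case: ifP => // _.
  by rewrite mulrBr; case: (h e); rewrite /sgn /=; clear; lia.
exists h; split.
  move=> A; rewrite key -isumN.
  have : \sumz_(e in P) (- (if e \in J then 0 else sgn (h e) * (((p e).1 \in A)%:Z - ((p e).2 \in A)%:Z)))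
    <= \sumz_(e in P) (crossing p A e)%:Z.
    apply: isum_le => e _; rewrite /crossing /sgn; clear.
    by case: (e \in J); case: (h e); case: (_ \in A); case: (_ \in A) => /=; lia.
  by clear; case: (a \in A); case: (odd _) => /=; lia.
have := key setT; rewrite [X in _ = _ - X]isum0 => [|e _]; last by rewrite !inE subrr mulr0 if_same.
rewrite in_setT (_ : isum Ng _ = 2 * \sumz_(e in Ng) sgn (h e)); last first.
  by rewrite -isumZ; apply: eq_isum => e _; rewrite !inE; clear; lia.
by clear; lia.
Qed.

Lemma positive_cuts_flow : pq_flow p (2 * k + 1) k sigma.
Proof.
(* The tour needs an origin; without vertices conservation is vacuous. *)
have [V0|[a _]] := set_0Vmem [set: V].
  exists (fun e => (true, sigma e)), (fun=> k%:Z); split.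
  - by move=> e /=; case: (sigma e).
  - by move=> v; have := in_setT v; rewrite V0 inE.
  - by move=> e; lia.
have [h [hA hT]] := neg_labels a.
pose Src := [set e in Ng | ~~ h e].
have SrcN : Src \subset Ng by apply/subsetP => e; rewrite inE => /andP[].
have cSrc : (#|Ng|)%:Z = 2 * (#|Src|)%:Z + (odd #|Ng|)%:Z.
  rewrite -hT -(isum_card SrcN) -{1}(isum_card (subxx Ng)) -isumZ -isumD; apply: eq_isum => e eN.
  by rewrite [e \in Src]inE eN /=; case: (h e).
have [|Sp SpS cSp] := @subset_card _ Src (if odd #|Ng| then k else 0%N).
  by case: neg_card cSrc; case: (odd _) => //=; clear; lia.
have SpN := subset_trans SpS SrcN.
pose g e : int := k%:Z + (e \in Sp)%:Z.
pose inc e A : int := ((p e).1 \in A)%:Z + ((p e).2 \in A)%:Z.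
pose beta v := \sumz_(e in Ng) (sgn (h e) * g e * inc e [set v]).
have betaA A : isum A beta = k%:Z * (\sumz_(e in Ng) (sgn (h e) * inc e A)) - \sumz_(e in Ng) ((e \in Sp)%:Z * inc e A).
  rewrite isum_exchange -isumZ -isumB; apply: eq_isum => e eN.
  rewrite isumZ.
  have -> : \sumz_(v in A) inc e [set v] = inc e A.
    by rewrite /inc isumD; congr (_ + _); rewrite -isum_pt; apply: eq_isum => v _; rewrite inE.
  rewrite /g; case eS: (e \in Sp); last by clear; lia.
  by have := subsetP SpS _ eS; rewrite inE => /andP[_ /negPf ->]; rewrite /sgn; clear; lia.
(* In the odd case the labels leave a surplus of [2 * k], cancelled by the [k] raised source edges,
   which count at both ends. *)
have beta0 : isum setT beta = 0.
  rewrite betaA; have inc2 e : inc e setT = 2 by rewrite /inc !inE.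
  rewrite (eq_isum (g := fun e => 2 * sgn (h e))) => [|e _]; last by rewrite inc2 mulrC.
  rewrite [X in _ - X](eq_isum (g := fun e => 2 * (e \in Sp)%:Z)) => [|e _]; last by rewrite inc2 mulrC.
  rewrite !isumZ isum_card // hT cSp; clear; by case: (odd _); lia.
have betaC A : isum A beta <= k%:Z * (\sumz_(e in P) (crossing p A e)%:Z) + 2 * k%:Z.
  have h1 := hA A; have : 0 <= \sumz_(e in Ng) ((e \in Sp)%:Z * inc e A).
    by apply: isum_ge0 => e; rewrite /inc; clear; lia.
  have h2 : k%:Z * (\sumz_(e in Ng) (sgn (h e) * inc e A)) <=
      k%:Z * (2 * (odd #|Ng|)%:Z + \sumz_(e in P) (crossing p A e)%:Z).
    by apply: ler_wpM2l => //; apply: h1.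
  rewrite betaA; move: h2; rewrite mulrDr.
  move: (isum _ _) (k%:Z * isum _ _) (isum _ _) => x y z.
  by clear; case: (odd _) => /=; lia.
pose deg v : int := \sumz_(e in P) inc e [set v].
have deg2 : isum setT deg = 2 * #|P|%:Z.
  rewrite isum_exchange -(isum_card (subxx P)) -isumZ; apply: eq_isum => e eP.
  rewrite eP; have -> : \sumz_(v in setT) inc e [set v] = \sumz_(v in setT) (((p e).1 == v)%:Z + ((p e).2 == v)%:Z).
    by apply: eq_isum => v _; rewrite /inc !inE.
  by rewrite isumD !isum_pt !inE.
have M2 : 2 <= 2 * k%:Z + 1 by move: k0; clear; lia.
(* Values [k] along the orientation give [v] the net value [2 * k] times its out-degree, minus
   [k * deg v], plus [beta v]. Since [2 * k] is [-1] modulo [2 * k + 1], this vanishes for the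
   out-degree requested here. *)
have [||o ho] := @orientation_mod (2 * k%:Z + 1) P (fun v => beta v - k%:Z * deg v) M2.
- by exists (- #|P|%:Z); rewrite isumB isumZ beta0 deg2; clear; lia.
- by move=> A A0 AT; have := pos_cut A0 AT; clear; lia.
pose psi e : int := if o e then k%:Z else - k%:Z.
have k1 : 1 <= k%:Z by move: k0; clear; lia.
have tv : two_valued k%:Z psi by move=> e; rewrite /psi; case: (o e); clear; lia.
have [v|psi' tv' net0] := rounding (p := p) (P := P) (beta := beta) k1 tv _ beta0 betaC.
  have [j hj] := ho v; exists (beta v - k%:Z * deg v + 2 * k%:Z * j).
  rewrite /net; have -> : \sumz_(e in P) (psi e * (((p e).1 == v)%:Z - ((p e).2 == v)%:Z)) =
    \sumz_(e in P) (2 * k%:Z * (tail p o e == v)%:Z - k%:Z * inc e [set v]).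
    apply: eq_isum => e _; rewrite /psi /tail /inc !inE; clear; by case: (o e); lia.
  by rewrite isumB !isumZ hj -/(deg v); clear; lia.
exists (fun e => if sigma e then (h e, h e) else (0 < psi' e, ~~ (0 < psi' e))),
  (fun e => if sigma e then g e else `|psi' e|); split.
- by move=> e; case: (sigma e); rewrite ?eqxx //; case: (0 < _).
- move=> v; rewrite conservationE -[RHS](net0 v) (isum_setC Ng) addrC; congr (_ + _).
    apply: eq_isum => e; rewrite !inE => /negPf -> /=.
    by have := tv' e; move: k1; rewrite /sgn; clear; case: (ltrP 0 (psi' e)) => h /=; lia.
  apply: eq_isum => e; rewrite inE => -> /=.
  by rewrite /inc !inE; clear; lia.
- move=> e; case: (sigma e).
    by rewrite /g; clear; lia.
  by have := tv' e; clear; lia.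
Qed.
End PositiveCuts.
End SignedFlows.

(** * Switching and the conclusion *)

Section Switching.
Variables (V E : finType) (ends : E -> V * V).
Implicit Types (A S : {set V}) (sigma : signature E).

Definition switch S sigma : signature E := [ffun e => sigma e (+) crossing ends S e].

Lemma switch_equivalent S sigma : switching_equivalent ends sigma (switch S sigma).
Proof.
have [n] := ubnP #|S|; elim: n S => // n IH S Sn.
have [->|[v vS]] := set_0Vmem S.
  have -> : switch set0 sigma = sigma by apply/ffunP => e; rewrite ffunE /crossing !inE !addbF.
  exact: rt_refl.
apply: (rt_trans _ _ _ (switch (S :\ v) sigma)).
  by apply: IH; move: Sn; rewrite (cardsD1 v) vS add1n ltnS.
apply: rt_step; exists v; apply/ffunP => e; rewrite !ffunE -addbA; congr (_ (+) _).
rewrite /crossing !inE; case: (eqVneq (ends e).1 v) => [->|_]; case: (eqVneq (ends e).2 v) => [->|_];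
  by rewrite ?vS /= ?addbF ?addbT //; case: (_ \in S).
Qed.

(** Inverting all bits at the vertices of [S] realises the switch. It negates the conservation
    equations there and keeps all values. *)
Lemma pq_flow_switch p q S sigma : pq_flow ends p q (switch S sigma) -> pq_flow ends p q sigma.
Proof.
move=> [tau [f [ot ct bf]]].
exists (fun e => ((tau e).1 (+) ((ends e).1 \in S), (tau e).2 (+) ((ends e).2 \in S))), f; split=> //.
  move=> e; have := ot e; rewrite ffunE /crossing /=.
  by case: (tau e) => -[] [] /=; case: (sigma e); case: (_ \in S); case: (_ \in S).
have half b x (c : bool) : half_val (b (+) c) x = ((if c then - half_val b x else half_val b x))%R.
  by case: c; case: b; rewrite /half_val /= ?opprK.
move=> v; rewrite (eq_bigr (fun e => if v \in S then - half_val (tau e).1 (f e) else half_val (tau e).1 (f e))%R);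
  last by move=> e /eqP ev; rewrite half ev.
rewrite [X in (_ + X)%R](eq_bigr (fun e => if v \in S then - half_val (tau e).2 (f e) else half_val (tau e).2 (f e))%R);
  last by move=> e /eqP ev; rewrite half ev.
have := ct v; case: (v \in S) => //.
by rewrite !sumrN -opprD => ->; rewrite oppr0.
Qed.

Lemma switch_switch A S sigma e : switch [set v | (v \in S) (+) (v \in A)] sigma e = switch S sigma e (+) crossing ends A e.
Proof.
rewrite !ffunE /crossing !inE; case: (sigma e).
all: by case: (_ \in S); case: (_ \in S); case: (_ \in A); case: (_ \in A).
Qed.

(** Choose [S] with the fewest negative edges. Switching [A] as well changes the sign of exactly the
    edges crossing [A], and cannot lower that number. *)
Lemma min_switching sigma : exists S, forall A,
  (\sumz_(e in negative_edges (switch S sigma)) (crossing ends A e)%:Z <=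
   \sumz_(e in ~: negative_edges (switch S sigma)) (crossing ends A e)%:Z)%R.
Proof.
pose S := [arg min_(S < set0) #|negative_edges (switch S sigma)|]; exists S => A.
have : #|negative_edges (switch S sigma)| <= #|negative_edges (switch [set v | (v \in S) (+) (v \in A)] sigma)|.
  by rewrite /S; case: arg_minnP => // S0 _; apply.
have card T : (#|negative_edges T|%:Z = \sumz_(e in setT) (T e)%:Z)%R.
  by rewrite -(isum_card (subsetT _)); apply: eq_isum => e _; rewrite inE.
rewrite -lez_nat !card -subr_ge0 -isumB.
rewrite (isum_setC (negative_edges (switch S sigma))).
have -> : (\sumz_(e in negative_edges (switch S sigma)) ((switch [set v | (v \in S) (+) (v \in A)] sigma e)%:Z - (switch S sigma e)%:Z)
  = - \sumz_(e in negative_edges (switch S sigma)) (crossing ends A e)%:Z)%R.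
  rewrite -isumN; apply: eq_isum => e; rewrite inE switch_switch => ->.
  by case: (crossing _ _ _).
rewrite (eq_isum (S := ~: _) (g := fun e => (crossing ends A e)%:Z%R)); first by rewrite addrC subr_ge0.
move=> e; rewrite !inE switch_switch => /negPf ->; by rewrite subr0.
Qed.
End Switching.

Theorem theorem6 (k : nat) (V E : finType) (ends : E -> V * V)
    (sigma : signature E) :
  0 < k ->
  edge_connected ends (12 * k - 1) ->
  essentially_unbalanced ends (2 * k + 1) sigma ->
  pq_flow ends (2 * k + 1) k sigma.
Proof.
move=> k0 conn unb; have [S minS] := min_switching ends sigma.
apply: (@pq_flow_switch _ _ ends _ _ S); apply: positive_cuts_flow => //; last first.
  exact: unb (switch_equivalent ends S sigma).
(* At least half of the [12 * k - 1] or more crossing edges are positive; as their number is an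
   integer, it is at least [6 * k]. *)
move=> A A0 AT; have := conn A A0 AT; have := minS A.
rewrite -lez_nat -(isum_card (subsetT _)).
rewrite (isum_setC (negative_edges (switch ends S sigma))).
have eqc P : (\sumz_(e in P) (e \in [set e | ((ends e).1 \in A) != ((ends e).2 \in A)])%:Z =
  \sumz_(e in P) (crossing ends A e)%:Z)%R.
  by apply: eq_isum => e _; rewrite inE /crossing; case: (_ \in A); case: (_ \in A).
rewrite !eqc; move: k0; clear; lia.
Qed.
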